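(* The birational Cremona transformation $C$ on Plücker space $\mathbb{P}$ is an involution that maps $G(1,d)$ to $LG(d)$ birationally. The indeterminacy locus of $C$ has codimension $3$ and consists of the linear subspaces $$L_{ijk}:\ p_{0i}=p_{0j}=p_{0k}=0\quad\text{for } 1\le i<j<k\le d,\qquad\text{and}\qquad L_{ij}:\ p_{ij}=p_{0i}=p_{0j}=0\quad\text{for } 1\le i<j\le d.$$ The indeterminacy locus of the Cremona transformation restricted to $G(1,d)$ has $\binom{d}{2}+1$ components, all of codimension $2$. One component is the set of lines at infinity, while the other components consist of the sets of lines whose direction vectors have at least two coordinates equal to $0$. The indeterminacy locus of the Cremona transformation restricted to $LG(d)$ has codimension $3$ and consists of the intersections of the subspaces $L_{ijk}$ and $L_{ij}$ with $LG(d)$. This indeterminacy locus in $LG(d)$ is the image under $C$ of lines whose direction vectors have one coordinate equal to $0$.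
   Context: $\mathbb{P}^d$ has homogeneous coordinates $z_0,z_1,\dots,z_d$, with $\mathbb{R}^d$ (or affine space) the part $z_0\ne0$ and hyperplane at infinity $z_0=0$. Plücker space $\mathbb{P}$ is the projective space with $\binom{d+1}{2}$ homogeneous coordinates $p_{0i}$ ($1\le i\le d$) and $p_{ij}$ ($1\le i<j\le d$). The affine line through $x$ with direction vector $v$ has Plücker coordinates $p_{0i}=v_i$ and $p_{ij}=x_iv_j-x_jv_i$; thus $(p_{01},\dots,p_{0d})$ is its direction vector. $G(1,d)\subset\mathbb{P}$ is the Grassmannian of lines in $\mathbb{P}^d$, defined by the Plücker relations $p_{0i}p_{jk}-p_{0j}p_{ik}+p_{0k}p_{ij}=0$ ($1\le i<j<k\le d$) and $p_{ij}p_{kl}-p_{ik}p_{jl}+p_{il}p_{jk}=0$ ($1\le i<j<k<l\le d$). The Cremona transformation is the rational map $C:\mathbb{P}\dashrightarrow\mathbb{P}$, $q=C(p)$, given by $$q_{0i}=\frac{1}{p_{0i}}\ (1\le i\le d),\qquad q_{ij}=\frac{p_{ij}}{p_{0i}p_{0j}}\ (1\le i<j\le d).$$ $LG(d)\subset\mathbb{P}$ is the linear subspace of dimension $2d-2$ defined by $q_{jk}-q_{ik}+q_{ij}=0$ for $1\le i<j<k\le d$.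
   Formalization: d ≥ 3 is assumed (the component count fails for d = 2). The last sentence is false: the image of lines with exactly one zero coordinate lies in the indeterminacy locus in LG(d), but its closure is only a union of d lines; this is what is proved. *)

(* Defs.v *)
From mathcomp Require Import all_boot all_order all_algebra.
From mathcomp Require Import boolp classical_sets functions cardinality.
From mathcomp Require Import mpoly.

Set Implicit Arguments.
Unset Strict Implicit.
Unset Printing Implicit Defensive.

Import GRing.Theory.
Local Open Scope ring_scope.
Local Open Scope classical_set_scope.

(* Projective geometry over a field K, with homogeneous coordinates indexed
   by a finite type I.  A point is given by a nonzero coordinate vector
   x : {ffun I -> K}, two vectors giving the same point when they are
   proportional ([same_point]).  A subset of projective space is represented
   by the set of all coordinate vectors of its points; zero is never one of
   them. *)

Definition same_point (K : fieldType) (I : finType) (x y : {ffun I -> K}) :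
  Prop := exists2 c : K, c != 0 & y = [ffun a => c * x a].

Definition proj_space (K : fieldType) (I : finType) : set {ffun I -> K} :=
  [set x | x != 0].

Definition peval (K : fieldType) (I : finType) (x : {ffun I -> K})
  (f : {mpoly K[#|I|]}) : K := f.@[fun k => x (enum_val k)].

(* Zariski topology, irreducible components, dimension *)

Definition zclosed (K : fieldType) (I : finType) (A : set {ffun I -> K}) :
    Prop :=
  exists2 S : set {mpoly K[#|I|]},
    (forall f, S f -> exists e : nat, f \is e.-homog)
    & A = [set x | x != 0 /\ forall f, S f -> peval x f = 0].

Definition zclosure (K : fieldType) (I : finType) (A : set {ffun I -> K}) :
  set {ffun I -> K} := smallest (@zclosed K I) A.

Definition irreducible (K : fieldType) (I : finType) (A : set {ffun I -> K}) :
    Prop :=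
  A !=set0 /\
  forall B C, zclosed B -> zclosed C -> A `<=` B `|` C ->
    A `<=` B \/ A `<=` C.

Definition variety (K : fieldType) (I : finType) (A : set {ffun I -> K}) :
  Prop := zclosed A /\ irreducible A.

Definition component (K : fieldType) (I : finType) (A Z : set {ffun I -> K}) :
    Prop :=
  [/\ variety Z, Z `<=` A
    & forall W, variety W -> Z `<=` W -> W `<=` A -> W = Z].

Definition variety_chain (K : fieldType) (I : finType)
    (A : set {ffun I -> K}) (n : nat) : Prop :=
  exists Z : nat -> set {ffun I -> K},
    (forall k, (k <= n)%N -> variety (Z k) /\ Z k `<=` A) /\
    (forall k, (k < n)%N -> Z k `<` Z k.+1).

(* Krull dimension; no n qualifies when A is empty. *)
Definition has_dim (K : fieldType) (I : finType) (A : set {ffun I -> K})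
    (n : nat) : Prop :=
  variety_chain A n /\ forall m, variety_chain A m -> (m <= n)%N.

Definition has_codim (K : fieldType) (I : finType)
    (X A : set {ffun I -> K}) (c : nat) : Prop :=
  A `<=` X /\ exists n, has_dim A n /\ has_dim X (n + c)%N.

(* Rational maps.  The map X --> Y is given by a function f on the dense open
   part X `&` U of X.  Its domain of definition may be larger: it consists of
   the points of X at which some tuple of forms of the same degree that agrees
   with f on X `&` U does not vanish. *)

Definition feval (K : fieldType) (I J : finType) (F : J -> {mpoly K[#|I|]})
  (x : {ffun I -> K}) : {ffun J -> K} := [ffun a => peval x (F a)].

Definition represents (K : fieldType) (I J : finType) (X U : set {ffun I -> K})
    (f : {ffun I -> K} -> {ffun J -> K}) (F : J -> {mpoly K[#|I|]}) : Prop :=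
  (exists e : nat, forall a, F a \is e.-homog) /\
  forall x, X x -> U x ->
    forall a b, feval F x a * f x b = feval F x b * f x a.

Definition defined_at (K : fieldType) (I J : finType) (X U : set {ffun I -> K})
    (f : {ffun I -> K} -> {ffun J -> K}) (x : {ffun I -> K}) : Prop :=
  exists2 F : J -> {mpoly K[#|I|]}, represents X U f F & feval F x != 0.

Definition indeterminacy (K : fieldType) (I J : finType)
    (X U : set {ffun I -> K}) (f : {ffun I -> K} -> {ffun J -> K}) :
  set {ffun I -> K} := [set x | X x /\ ~ defined_at X U f x].

(* Values are taken at the points of D where the map X --> Y is defined. *)
Definition rat_image (K : fieldType) (I J : finType) (X U : set {ffun I -> K})
    (f : {ffun I -> K} -> {ffun J -> K}) (D : set {ffun I -> K}) :
    set {ffun J -> K} :=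
  [set y | exists x F, [/\ D x, represents X U f F, feval F x != 0
                         & same_point (feval F x) y]].

Definition rational_map (K : fieldType) (I J : finType)
    (X : set {ffun I -> K}) (Y : set {ffun J -> K}) (U : set {ffun I -> K})
    (f : {ffun I -> K} -> {ffun J -> K}) : Prop :=
  [/\ variety X /\ variety Y,
      X `&` U !=set0,
      (exists2 B, zclosed B & X `&` U = X `\` B),
      (forall x, X x -> U x -> Y (f x))
    & (forall x, X x -> U x -> defined_at X U f x)].

Definition birational_map (K : fieldType) (I J : finType)
    (X : set {ffun I -> K}) (Y : set {ffun J -> K}) (U : set {ffun I -> K})
    (f : {ffun I -> K} -> {ffun J -> K}) : Prop :=
  rational_map X Y U f /\
  exists (V : set {ffun J -> K}) (g : {ffun J -> K} -> {ffun I -> K}),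
    [/\ rational_map Y X V g,
        (exists x, [/\ X x, U x & V (f x)]),
        (exists y, [/\ Y y, V y & U (g y)]),
        (forall x, X x -> U x -> V (f x) -> same_point x (g (f x)))
      & (forall y, Y y -> V y -> U (g y) -> same_point y (f (g y)))].

(* Pluecker space: coordinates p_ij with 0 <= i < j <= d. *)

Definition pidx (d : nat) : finType :=
  {ij : 'I_d.+1 * 'I_d.+1 | (ij.1 < ij.2)%N}.

(* p_ij for i < j; junk value 0 otherwise *)
Definition plu (K : fieldType) (d : nat) (p : {ffun pidx d -> K})
  (i j : 'I_d.+1) : K := oapp p 0 (insub (i, j)).

(* With i = 0 these are the relations involving the p_0i. *)
Definition grassmannian (K : fieldType) (d : nat) : set {ffun pidx d -> K} :=
  [set p | p != 0 /\
     forall i j k l : 'I_d.+1, (i < j)%N -> (j < k)%N -> (k < l)%N ->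
       plu p i j * plu p k l - plu p i k * plu p j l
         + plu p i l * plu p j k = 0].

Definition LG (K : fieldType) (d : nat) : set {ffun pidx d -> K} :=
  [set q | q != 0 /\
     forall i j k : 'I_d.+1, (0 < i)%N -> (i < j)%N -> (j < k)%N ->
       plu q j k - plu q i k + plu q i j = 0].

Definition dirvec (K : fieldType) (d : nat) (p : {ffun pidx d -> K})
  (i : 'I_d.+1) : K := plu p ord0 i.

Definition torus (K : fieldType) (d : nat) : set {ffun pidx d -> K} :=
  [set p | forall i : 'I_d.+1, (0 < i)%N -> dirvec p i != 0].

(* The formula on [torus]; elsewhere division by zero gives junk values, which
   [represents] ignores. *)
Definition cremona (K : fieldType) (d : nat) (p : {ffun pidx d -> K}) :
    {ffun pidx d -> K} :=
  [ffun ij => let: (i, j) := val ij in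
     if i == ord0 then (dirvec p j)^-1
     else plu p i j / (dirvec p i * dirvec p j)].

Definition L3 (K : fieldType) (d : nat) (i j k : 'I_d.+1) :
    set {ffun pidx d -> K} :=
  [set p | p != 0 /\ [/\ dirvec p i = 0, dirvec p j = 0 & dirvec p k = 0]].

Definition L2 (K : fieldType) (d : nat) (i j : 'I_d.+1) :
    set {ffun pidx d -> K} :=
  [set p | p != 0 /\ [/\ plu p i j = 0, dirvec p i = 0 & dirvec p j = 0]].

Definition base_subspaces (K : fieldType) (d : nat) : set {ffun pidx d -> K} :=
  [set p | (exists i j k : 'I_d.+1,
              [/\ (0 < i)%N, (i < j)%N, (j < k)%N & L3 i j k p]) \/
           (exists i j : 'I_d.+1, [/\ (0 < i)%N, (i < j)%N & L2 i j p])].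

Definition lines_at_infinity (K : fieldType) (d : nat) :
    set {ffun pidx d -> K} :=
  [set p | grassmannian p /\ forall i : 'I_d.+1, (0 < i)%N -> dirvec p i = 0].

(* The affine lines with v_i = v_j = 0 are not a closed set: the closure also
   contains some lines at infinity. *)
Definition two_zero_lines (K : fieldType) (d : nat) (i j : 'I_d.+1) :
    set {ffun pidx d -> K} :=
  zclosure ([set p | [/\ grassmannian p, dirvec p i = 0 & dirvec p j = 0]]
            `\` @lines_at_infinity K d).

Definition one_zero_lines (K : fieldType) (d : nat) (i : 'I_d.+1) :
    set {ffun pidx d -> K} :=
  [set p | [/\ grassmannian p, dirvec p i = 0
     & forall j : 'I_d.+1, (0 < j)%N -> j != i -> dirvec p j != 0]].

(* Main.v *)
(* Let F represent C on X, where X is Pluecker space, G(1,d) or LG(d). On X one has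
   F_0i p_0i = F_0j p_0j and F_ij p_0j = F_0i p_ij. Since X and its sections
   p_0i = 0 are irreducible, p_0j can be cancelled on them, so F_0j vanishes where
   p_0i = 0 (i <> j), and F_kl vanishes where p_0m = 0 (m <> k, l). Only F_ij is
   left to be treated on the locus p_0i = p_0j = 0: on Pluecker space and LG(d) it
   vanishes where p_ij = 0, and on G(1,d) it vanishes on the whole locus by the
   Pluecker relation. Conversely, the products p_ij prod_(k <> i,j) p_0k represent C
   and their common zeros are the subspaces L_ijk and L_ij.

   All dimensions come from charts, which are polynomial maps from K^n whose
   parameters can be read off linearly. The closures of the images of the coordinate
   subspaces of K^n form a chain of length n. No chain is longer: forms f_k that
   vanish on Z_k but not on Z_(k+1) are algebraically independent on the top of the
   chain, while n+1 polynomials in n variables are dependent. *)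

Require Import Defs.
From mathcomp Require Import all_boot all_order all_algebra.
From mathcomp Require Import boolp classical_sets functions cardinality.
From mathcomp Require Import mpoly.
From mathcomp Require Import ring zify.
From mathcomp Require finmap.

Set Implicit Arguments.
Unset Strict Implicit.
Unset Printing Implicit Defensive.

Import GRing.Theory.
Local Open Scope ring_scope.
Local Open Scope classical_set_scope.

(** * Polynomial functions and forms *)

(** The field is only infinite and varieties are sets of K-points, so irreducibility is obtained
    from points, without a Nullstellensatz. Each set concerned is, up to passing to an open part or
    a closure, the nonzero part of the image of a polynomial map on a linear parameter space. Two of
    its points are joined by a polynomial curve, and finitely many nonzero polynomials in one
    variable have a common nonroot. For G(1,d), its sections p_0i = 0 and the lines at infinity, the
    map sends two points to the line joining them; a single chart would miss some lines.

    F is an arbitrary representation, so cancelling a form on an irreducible set stands in for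
    factoriality of coordinate rings. This lets one argument serve Pluecker space, G(1,d) and LG(d).

    On p_0i = p_0j = 0 the relation with indices 0, i, j, m reads p_0m p_ij = 0. A line there is
    thus at infinity or has p_ij = 0, which separates the lines at infinity from the closures of the
    affine families and gives the count 'C(d, 2) + 1.

    C contracts the divisor p_0i = 0 of G(1,d) to a projective line. Hence the image of these lines
    is shown to lie in the locus on LG(d), and its closure is determined. *)

Section PolynomialFunctions.
Variable K : fieldType.

Definition pfun (I : finType) (g : {ffun I -> K} -> K) : Prop :=
  exists f : {mpoly K[#|I|]}, forall x, peval x f = g x.

(** Forms are handled through the functions they define, so that identities between them are
    pointwise and open to [ring]. The degree is an index of the predicate because the zero function
    has every degree. *)
Definition isform (I : finType) (e : nat) (g : {ffun I -> K} -> K) : Prop :=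
  exists2 f : {mpoly K[#|I|]}, f \is e.-homog & forall x, peval x f = g x.

Section Closure.
Variable I : finType.
Implicit Types (g h : {ffun I -> K} -> K) (f : {mpoly K[#|I|]}).

Lemma isform_pfun e g : isform e g -> pfun g.
Proof. by case=> f _ fg; exists f. Qed.

Lemma pfun_cst c : @pfun I (fun=> c).
Proof. by exists c%:MP => x; rewrite /peval mevalC. Qed.

Lemma pfun_coord a : @pfun I (fun x => x a).
Proof. by exists 'X_(enum_rank a) => x; rewrite /peval mevalXU enum_rankK. Qed.

Lemma pfunD g h : pfun g -> pfun h -> pfun (fun x => g x + h x).
Proof.
by move=> [f fg] [f' fh]; exists (f + f') => x; rewrite /peval mevalD -fg -fh.
Qed.

Lemma pfunN g : pfun g -> pfun (fun x => - g x).
Proof. by move=> [f fg]; exists (- f) => x; rewrite /peval mevalN -fg. Qed.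

Lemma pfunB g h : pfun g -> pfun h -> pfun (fun x => g x - h x).
Proof. by move=> pg ph; apply: pfunD => //; apply: pfunN. Qed.

Lemma pfunM g h : pfun g -> pfun h -> pfun (fun x => g x * h x).
Proof.
by move=> [f fg] [f' fh]; exists (f * f') => x; rewrite /peval mevalM -fg -fh.
Qed.

Lemma isform_cst c : @isform I 0 (fun=> c).
Proof.
exists c%:MP => [|x]; last by rewrite /peval mevalC.
by rewrite -[c%:MP]mulr1 mul_mpolyC; apply: dhomogZ; apply: dhomog1.
Qed.

Lemma isform0 e : @isform I e (fun=> 0).
Proof. by exists 0 => [|x]; [apply: dhomog0 | rewrite /peval meval0]. Qed.

Lemma isform_coord a : @isform I 1 (fun x => x a).
Proof.
exists 'X_(enum_rank a) => [|x]; last by rewrite /peval mevalXU enum_rankK.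
by rewrite dhomogX /= mdeg1.
Qed.

Lemma isformD e g h : isform e g -> isform e h -> isform e (fun x => g x + h x).
Proof.
move=> [f ef fg] [f' ef' fh]; exists (f + f') => [|x]; first exact: dhomogD.
by rewrite /peval mevalD -fg -fh.
Qed.

Lemma isformN e g : isform e g -> isform e (fun x => - g x).
Proof.
move=> [f ef fg]; exists (- f) => [|x]; first by rewrite dhomogN.
by rewrite /peval mevalN -fg.
Qed.

Lemma isformB e g h : isform e g -> isform e h -> isform e (fun x => g x - h x).
Proof. by move=> pg ph; apply: isformD => //; apply: isformN. Qed.

Lemma isformM e e' g h :
  isform e g -> isform e' h -> isform (e + e') (fun x => g x * h x).
Proof.
move=> [f ef fg] [f' ef' fh]; exists (f * f') => [|x]; first exact: dhomogM.
by rewrite /peval mevalM -fg -fh.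
Qed.

Lemma isformX e g k : isform e g -> isform (e * k) (fun x => g x ^+ k).
Proof.
move=> [f ef fg]; exists (f ^+ k) => [|x]; first exact: dhomogMn.
by rewrite /peval rmorphXn /= -fg.
Qed.

Lemma isformZ e c g : isform e g -> isform e (fun x => c * g x).
Proof. by move=> fg; rewrite -[e]add0n; apply: isformM => //; apply: isform_cst. Qed.

Lemma isform_sum (T : Type) (s : seq T) (P : pred T) e
    (g : T -> {ffun I -> K} -> K) :
  (forall t, P t -> isform e (g t)) -> isform e (fun x => \sum_(t <- s | P t) g t x).
Proof.
move=> eg; elim: s => [|t s [f ef fE]].
  by exists 0 => [|x]; rewrite ?dhomog0 // big_nil /peval meval0.
have [Pt|nPt] := boolP (P t); last first.
  by exists f => // x; rewrite big_cons (negPf nPt).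
have [f' ef' f'E] := isformD (eg t Pt) (ex_intro2 _ _ f ef fE).
by exists f' => // x; rewrite big_cons Pt.
Qed.

Lemma isform_prod (T : Type) (s : seq T) (P : pred T) (e : T -> nat)
    (g : T -> {ffun I -> K} -> K) :
  (forall t, P t -> isform (e t) (g t)) ->
  isform (\sum_(t <- s | P t) e t) (fun x => \prod_(t <- s | P t) g t x).
Proof.
move=> eg; elim: s => [|t s [f ef fE]].
  rewrite big_nil; have [f ef fE] := isform_cst 1.
  by exists f => // x; rewrite big_nil.
rewrite big_cons; have [Pt|nPt] := boolP (P t); last first.
  by exists f => // x; rewrite big_cons (negPf nPt).
have [f' ef' f'E] := isformM (eg t Pt) (ex_intro2 _ _ f ef fE).
by exists f' => // x; rewrite big_cons Pt.
Qed.

Lemma isform_ext e g h : g =1 h -> isform e g -> isform e h.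
Proof. by move=> gh [f ef fE]; exists f => // x; rewrite -gh. Qed.

Lemma isformW e e' g : e = e' -> isform e g -> isform e' g.
Proof. by move=> ->. Qed.

Lemma isform_scale e g (c : K) (x : {ffun I -> K}) :
  isform e g -> g [ffun a => c * x a] = c ^+ e * g x.
Proof.
move=> [f ef fg]; rewrite -!fg /peval !mevalE mulr_sumr.
rewrite !big_seq; apply: eq_bigr => m mf.
rewrite mulrCA; congr (_ * _).
under eq_bigr do rewrite ffunE exprMn.
rewrite big_split /=; congr (_ * _).
by rewrite -(dhomog_mf ef mf) /= mdegE prodrXr.
Qed.

Lemma isform_at0 e g : isform e.+1 g -> g 0 = 0.
Proof.
move=> fg; have := isform_scale 0 0 fg; rewrite expr0n mul0r => <-.
by congr g; apply/ffunP => a; rewrite !ffunE mul0r.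
Qed.

End Closure.

Lemma pfun_curve (I : finType) (g : {ffun I -> K} -> K) (c : I -> {poly K}) :
  pfun g -> exists q : {poly K}, forall t, q.[t] = g [ffun a => (c a).[t]].
Proof.
move=> [f fg].
exists (\sum_(m <- msupp f) f@_m *: \prod_i (c (enum_val i)) ^+ m i) => t.
rewrite -fg /peval mevalE horner_sum; apply: eq_bigr => m _.
rewrite hornerZ horner_prod; congr (_ * _); apply: eq_bigr => i _.
by rewrite horner_exp ffunE.
Qed.

(** Since [msize] is the degree plus one, the bound says that the degree of [q] is at most [D * e].
    Its linearity in [e] is what the count in [chain_le] rests on. *)
Lemma isform_comp (I : finType) n e D (g : {ffun I -> K} -> K)
    (c : I -> {mpoly K[n]}) :
  isform e g -> (forall a, (msize (c a) <= D.+1)%N) ->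
  exists2 q : {mpoly K[n]}, (msize q <= (D * e).+1)%N &
    forall v, q.@[v] = g [ffun a => (c a).@[v]].
Proof.
move=> [f ef fg] cD.
exists (\sum_(m <- msupp f) f@_m *: \prod_i (c (enum_val i)) ^+ m i); last first.
  move=> v; rewrite -fg /peval [RHS]mevalE raddf_sum; apply: eq_bigr => m _.
  rewrite /= mevalZ rmorph_prod; congr (_ * _); apply: eq_bigr => i _.
  by rewrite rmorphXn /= ffunE.
have msM p q k l : (msize p <= k.+1)%N -> (msize q <= l.+1)%N ->
    (msize (p * q : {mpoly K[n]}) <= (k + l).+1)%N.
  move=> pk ql; have [->|p0] := eqVneq p 0; first by rewrite mul0r msize0.
  have [->|q0] := eqVneq q 0; first by rewrite mulr0 msize0.
  rewrite msizeM //; move: (leq_add pk ql).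
  by rewrite addnS addSn; case: (_ + _)%N.
have msX p k l : (msize p <= k.+1)%N ->
    (msize (p ^+ l : {mpoly K[n]}) <= (k * l).+1)%N.
  move=> pk; elim: l => [|l IH]; first by rewrite expr0 muln0 msize1.
  by rewrite exprS mulnS; apply: msM.
rewrite big_seq; apply: (leq_trans (msize_sum _ _ _)).
apply/bigmax_leqP_seq => m _ mf.
apply: (leq_trans (msizeZ_le _ _)).
rewrite -(dhomog_mf ef mf) /= mdegE big_distrr /=.
elim/big_ind2: _ => [|p k q l pk ql|i _]; first by rewrite msize1.
  exact: msM.
exact: msX.
Qed.

Lemma isform_subst (I J : finType) e (g : {ffun I -> K} -> K)
    (h : I -> {ffun J -> K} -> K) :
  isform e g -> (forall a, isform 1 (h a)) ->
  isform e (fun y => g [ffun a => h a y]).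
Proof.
move=> [f ef fg] fh.
apply: (@isform_ext _ _ (fun y => \sum_(m <- msupp f | m \in msupp f)
  f@_m * \prod_i h (enum_val i) y ^+ m i)).
  move=> y; rewrite -fg /peval mevalE -big_seq; apply: eq_bigr => m _.
  by congr (_ * _); apply: eq_bigr => i _; rewrite ffunE.
apply: isform_sum => m mf; apply: (isformZ f@_m).
rewrite -(dhomog_mf ef mf) /= mdegE.
apply: isform_prod => i _; rewrite -[X in isform X]mul1n.
exact: (isformX (m i) (fh (enum_val i))).
Qed.

Lemma pfun_subst (I J : finType) (g : {ffun I -> K} -> K)
    (h : I -> {ffun J -> K} -> K) :
  pfun g -> (forall a, pfun (h a)) -> pfun (fun y => g [ffun a => h a y]).
Proof.
move=> [f fg] /choice[q qh].
exists (\sum_(m <- msupp f) f@_m *: \prod_i (q (enum_val i)) ^+ m i) => y.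
rewrite -fg /peval [RHS]mevalE raddf_sum; apply: eq_bigr => m _.
rewrite /= mevalZ rmorph_prod; congr (_ * _); apply: eq_bigr => i _.
by rewrite rmorphXn /= ffunE -qh.
Qed.

End PolynomialFunctions.

(** * Zariski topology *)

Section ZariskiTopology.
Variables (K : fieldType) (I : finType).
Implicit Types (A B Z W : set {ffun I -> K}) (x y : {ffun I -> K}).
Implicit Types (g : {ffun I -> K} -> K).

Lemma zclosed_neq0 A x : zclosed A -> A x -> x != 0.
Proof. by move=> [S _ ->] []. Qed.

Lemma zclosed_sub_proj A : zclosed A -> A `<=` @proj_space K I.
Proof. by move=> cA x; apply: zclosed_neq0. Qed.

Lemma zclosed_sep A x : zclosed A -> x != 0 -> ~ A x ->
  exists e g, [/\ isform e g, (forall a, A a -> g a = 0) & g x != 0].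
Proof.
move=> [S Sh ->] x0 nAx; apply: contrapT => nsep; apply: nAx.
split=> // f Sf; have [e ef] := Sh f Sf.
apply: contrapT => /eqP fx; apply: nsep.
exists e, (fun y => peval y f); split=> //; first by exists f.
by move=> a [_ /(_ f Sf)].
Qed.

Lemma scale_neq0 (c : K) x : c != 0 -> x != 0 -> [ffun a => c * x a] != 0.
Proof.
move=> c0; apply: contra_neq => /ffunP cx; apply/ffunP => a.
move: (cx a); rewrite !ffunE => /eqP.
by rewrite mulf_eq0 (negPf c0) => /eqP.
Qed.

Lemma zclosed_scale A (c : K) x : zclosed A -> c != 0 -> A x ->
  A [ffun a => c * x a].
Proof.
move=> cA c0 Ax; apply: contrapT => nA.
have [e [g [fg Ag]]] := zclosed_sep cA (scale_neq0 c0 (zclosed_neq0 cA Ax)) nA.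
by rewrite (isform_scale _ _ fg) Ag // mulr0 eqxx.
Qed.

Lemma zclosed_forms (T : Type) (e : T -> nat) (g : T -> {ffun I -> K} -> K) :
  (forall t, isform (e t) (g t)) ->
  zclosed [set x | x != 0 /\ forall t, g t x = 0].
Proof.
move=> fg; exists [set f | exists t, f \is (e t).-homog /\
                              forall x, peval x f = g t x].
  by move=> f [t [ef _]]; exists (e t).
rewrite predeqE => x; split=> -[x0 gx]; split=> //.
  by move=> f [t [_ ->]].
by move=> t; have [f ef fE] := fg t; rewrite -fE; apply: gx; exists t.
Qed.

Lemma zclosed_zeros e g : isform e g -> zclosed [set x | x != 0 /\ g x = 0].
Proof.
move=> fg; have := @zclosed_forms unit (fun=> e) (fun=> g) (fun=> fg).
congr zclosed; rewrite predeqE => x /=; split=> -[x0 gx]; split=> //.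
exact: gx tt.
Qed.

Lemma zclosedT : zclosed (@proj_space K I).
Proof.
have := zclosed_zeros (isform0 K I 0); congr zclosed.
by rewrite predeqE => x; split=> [[]|].
Qed.

Lemma zclosed0 : zclosed (@set0 {ffun I -> K}).
Proof.
have := zclosed_zeros (isform_cst I (1 : K)); congr zclosed.
by rewrite predeqE => x; split=> // -[_ /eqP]; rewrite oner_eq0.
Qed.

Lemma zclosedI A B : zclosed A -> zclosed B -> zclosed (A `&` B).
Proof.
move=> [S Sh ->] [S' S'h ->]; exists (S `|` S').
  by move=> f [/Sh|/S'h].
rewrite predeqE => x; split=> [[[x0 Sx] [_ S'x]]|[x0 SSx]].
  by split=> // f [/Sx|/S'x].
by split; split=> // f fS; apply: SSx; [left|right].
Qed.

Lemma zclosedU A B : zclosed A -> zclosed B -> zclosed (A `|` B).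
Proof.
move=> [S Sh ->] [S' S'h ->].
exists [set f | exists f1 f2, [/\ S f1, S' f2 & f = f1 * f2]].
  move=> _ [f1 [f2 [/Sh[e ef1] /S'h[e' ef2] ->]]].
  by exists (e + e')%N; apply: dhomogM.
rewrite predeqE => x; split=> [[] [x0 Sx]|[x0 SSx]].
- by split=> // _ [f1 [f2 [/Sx f1x _ ->]]]; rewrite /peval mevalM [X in X * _]f1x mul0r.
- by split=> // _ [f1 [f2 [_ /Sx f2x ->]]]; rewrite /peval mevalM [X in _ * X]f2x mulr0.
apply: contrapT => /not_orP[nS nS'].
apply: nS; split=> // f1 Sf1; apply: contrapT => /eqP f1x.
apply: nS'; split=> // f2 Sf2.
have /SSx/eqP : exists f3 f4, [/\ S f3, S' f4 & f1 * f2 = f3 * f4].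
  by exists f1, f2.
by rewrite /peval mevalM mulf_eq0 -/(peval x f1) (negPf f1x) => /eqP.
Qed.

Lemma zclosed_bigU (T : eqType) (s : seq T) (B : T -> set {ffun I -> K}) :
  (forall t, t \in s -> zclosed (B t)) ->
  zclosed [set x | exists2 t, t \in s & B t x].
Proof.
elim: s => [_|t s IH cB].
  by have := zclosed0; congr zclosed; rewrite predeqE => x; split=> // -[].
have cs : zclosed [set x | exists2 t, t \in s & B t x].
  by apply: IH => u us; apply: cB; rewrite in_cons us orbT.
have := zclosedU (cB t (mem_head _ _)) cs; congr zclosed.
rewrite predeqE => x; split=> [[Bx|[u us Bx]]|[u]].
- by exists t; rewrite ?mem_head.
- by exists u; rewrite // in_cons us orbT.
- by rewrite in_cons => /orP[/eqP->|us] Bx; [left|right; exists u].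
Qed.

(** Membership in a closure becomes a test by forms. If [A] contained the zero vector, no closed set
    would contain [A] and its closure would be everything. *)
Lemma zclosureP A x : A `<=` @proj_space K I ->
  zclosure A x <-> x != 0 /\ forall e g, isform e g ->
    (forall a, A a -> g a = 0) -> g x = 0.
Proof.
move=> A0; split=> [Ax|[x0 Ax] B [cB AB]].
  split; first by apply: (Ax (@proj_space K I)); split=> //; apply: zclosedT.
  move=> e g fg gA; have : [set x | x != 0 /\ g x = 0] x; last by case.
  apply: Ax; split; first exact: zclosed_zeros fg.
  by move=> a Aa; exact: conj (A0 _ Aa) (gA _ Aa).
apply: contrapT => nBx.
have [e [g [fg gB /eqP[]]]] := zclosed_sep cB x0 nBx.
by apply: Ax fg _ => a /AB/gB.
Qed.

Lemma zclosure_closed A : A `<=` @proj_space K I -> zclosed (zclosure A).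
Proof.
move=> A0.
have := @zclosed_forms {eg : nat * ({ffun I -> K} -> K) |
  isform eg.1 eg.2 /\ forall a, A a -> eg.2 a = 0} (fun t => (sval t).1)
  (fun t => (sval t).2) (fun t => (svalP t).1).
congr zclosed; rewrite predeqE => x; rewrite zclosureP //.
split=> -[x0 Ax]; split=> //; last by move=> [[e g] /= [fg gA]]; apply: Ax fg gA.
by move=> e g fg gA; apply: (Ax (exist _ (e, g) (conj fg gA))).
Qed.

Lemma sub_zclosure A : A `<=` zclosure A.
Proof. by move=> x Ax B [_]; apply. Qed.

Lemma zclosure_sub A B : zclosed B -> A `<=` B -> zclosure A `<=` B.
Proof. by move=> cB AB x; apply. Qed.

Lemma zclosureS A B : A `<=` B -> zclosure A `<=` zclosure B.
Proof. by move=> AB x Ax C [cC BC]; apply: Ax; split=> // y /AB/BC. Qed.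

(** [A] lies in the union of the zero sets of [g] and [h], and the point where [h] is nonzero rules
    out the second. This is cancellation of [h] from [g * h = 0] on [A], without any coordinate
    ring. *)
Lemma irr_cancel A e e' g h : irreducible A -> A `<=` @proj_space K I ->
  isform e g -> isform e' h -> (exists2 a, A a & h a != 0) ->
  (forall a, A a -> h a != 0 -> g a = 0) -> forall a, A a -> g a = 0.
Proof.
move=> [_ irrA] A0 fg fh [b Ab hb] gh.
have AU : A `<=` [set x | x != 0 /\ g x = 0] `|` [set x | x != 0 /\ h x = 0].
  move=> a Aa; have [ha|ha] := eqVneq (h a) 0; [right|left]; split=> //.
  - exact: A0.
  - exact: A0.
  - exact: gh.
have [sub a Aa|sub] := irrA _ _ (zclosed_zeros fg) (zclosed_zeros fh) AU.
  by have [] := sub a Aa.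
by have [_ /eqP] := sub b Ab; rewrite (negPf hb).
Qed.

Lemma irr_cover (T : eqType) (s : seq T) (B : T -> set {ffun I -> K}) A :
  irreducible A -> (forall t, t \in s -> zclosed (B t)) ->
  (forall x, A x -> exists2 t, t \in s & B t x) ->
  exists2 t, t \in s & A `<=` B t.
Proof.
move=> [[a Aa] irrA]; elim: s => [|t s IH] cB AB.
  by have [] := AB a Aa.
have cs u : u \in s -> zclosed (B u).
  by move=> us; apply: cB; rewrite in_cons us orbT.
have AU : A `<=` B t `|` [set x | exists2 u, u \in s & B u x].
  move=> x Ax; have [u] := AB x Ax.
  by rewrite in_cons => /orP[/eqP->|us] Bx; [left | right; exists u].
have [Bt|Bs] := irrA _ _ (cB t (mem_head _ _)) (zclosed_bigU cs) AU.
- by exists t; rewrite ?mem_head.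
- have [//|u us Au] := IH cs; by exists u; rewrite // in_cons us orbT.
Qed.

Lemma irr_closure A : irreducible A -> irreducible (zclosure A).
Proof.
move=> [[a Aa] irrA]; split; first by exists a; apply: sub_zclosure.
move=> B C cB cC AB; have [AsB|AsC] := irrA _ _ cB cC (subset_trans (@sub_zclosure A) AB).
- by left; apply: zclosure_sub.
- by right; apply: zclosure_sub.
Qed.

Lemma variety_closure A : irreducible A -> A `<=` @proj_space K I ->
  variety (zclosure A).
Proof. by move=> iA A0; split; [apply: zclosure_closed | apply: irr_closure]. Qed.

(** An irreducible subset of a finite union of closed sets lies in one of them, so the maximal
    varieties are among the [Z t]. Since no [Z t] lies in another, each of them is maximal. *)
Lemma component_cover (T : finType) (Z : T -> set {ffun I -> K}) A :
  (forall t, variety (Z t)) -> (forall t u, Z t `<=` Z u -> t = u) ->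
  (forall x, A x <-> exists t, Z t x) ->
  forall W, component A W <-> exists t, W = Z t.
Proof.
move=> vZ Zinj AZ W.
have cover B : irreducible B -> B `<=` A -> exists t, B `<=` Z t.
  move=> iB BA; have BZ x : B x -> exists2 t, t \in enum T & Z t x.
    by move=> /BA/AZ[t Zx]; exists t; rewrite ?mem_enum.
  by have [t _] := irr_cover iB (fun t _ => (vZ t).1) BZ; exists t.
split=> [[[cW iW] WA maxW]|[t ->{W}]].
  have [t WZ] := cover W iW WA.
  by exists t; rewrite (maxW (Z t)) // => x Zx; apply/AZ; exists t.
split=> // [x Zx|W [cW iW] ZW WA]; first by apply/AZ; exists t.
have [u WZ] := cover W iW WA.
rewrite eqEsubset; split=> //.
by rewrite (Zinj t u) // => x /ZW/WZ.
Qed.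

Lemma variety_chain_le A n m : (m <= n)%N -> variety_chain A n ->
  variety_chain A m.
Proof.
move=> mn [Z [vZ sZ]]; exists Z; split=> k km.
  by apply: vZ; apply: leq_trans mn.
by apply: sZ; apply: leq_trans mn.
Qed.

Lemma variety_chainS A B n : A `<=` B -> variety_chain A n -> variety_chain B n.
Proof.
move=> AB [Z [vZ sZ]]; exists Z; split=> // k /vZ[? ZA].
by split=> // x /ZA/AB.
Qed.

Lemma chain_sub (Z : nat -> set {ffun I -> K}) n :
  (forall k, (k < n)%N -> Z k `<` Z k.+1) -> forall k, (k <= n)%N -> Z k `<=` Z n.
Proof.
move=> sZ; elim: n sZ => [|n IH] sZ k; first by rewrite leqn0 => /eqP->.
rewrite leq_eqVlt => /orP[/eqP->//|kn].
apply: subset_trans (properW (sZ n (ltnSn n))).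
by apply: IH => // j jn; apply: sZ; apply: ltnW.
Qed.

(** The top of a chain is irreducible, so it lies in one member of the cover and takes the whole
    chain with it. Chains in [A] are therefore no longer than those in the members. *)
Lemma has_dim_cover (T : finType) (P : pred T) (B : T -> set {ffun I -> K}) A n :
  (forall t, P t -> zclosed (B t)) ->
  (forall x, A x -> exists2 t, P t & B t x) ->
  (forall t m, P t -> variety_chain (B t) m -> (m <= n)%N) ->
  variety_chain A n -> has_dim A n.
Proof.
move=> cB AB dB An; split=> // m [Z [vZ sZ]].
have [_ iZ] := (vZ m (leqnn m)).1.
have cBs t : t \in [seq t <- enum T | P t] -> zclosed (B t).
  by rewrite mem_filter => /andP[/cB].
have ZBs x : Z m x -> exists2 t, t \in [seq t <- enum T | P t] & B t x.
  move=> Zx; have [t Pt Bx] := AB x ((vZ m (leqnn m)).2 x Zx).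
  by exists t => //; rewrite mem_filter Pt mem_enum.
have [t] := irr_cover iZ cBs ZBs; rewrite mem_filter => /andP[Pt _] ZB.
apply: (dB t) => //; exists Z; split=> // k km; split; first exact: (vZ k km).1.
exact: subset_trans (chain_sub sZ km) ZB.
Qed.

End ZariskiTopology.

(** * Irreducibility by joining points with polynomial curves *)

Section Curves.
Variable K : fieldType.
Hypothesis K_inf : infinite_set [set: K].

(** The one place where the infinity of the field is used directly. *)
Lemma nonroot_exists (q : {poly K}) : q != 0 -> exists t, q.[t] != 0.
Proof.
move=> q0; apply: contrapT => nr.
have [B _ cB] := infinite_set_fset (size q) K_inf.
have qB : all (root q) (finmap.enum_fset B).
  apply/allP => t _; apply/rootP.
  by apply: contrapT => /eqP qt; apply: nr; exists t.
by have := max_poly_roots q0 qB (finmap.fset_uniq B); rewrite ltnNge cB.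
Qed.

Variable I : finType.
Implicit Types (A : set {ffun I -> K}).

Definition curve_at (c : I -> {poly K}) (t : K) : {ffun I -> K} :=
  [ffun a => (c a).[t]].

Lemma curve_comp (J : finType) (c : J -> {poly K})
    (Phi : {ffun J -> K} -> {ffun I -> K}) :
  (forall a, pfun (fun s => Phi s a)) ->
  exists c' : I -> {poly K}, forall t,
    curve_at c' t = Phi [ffun j => (c j).[t]].
Proof.
move=> pPhi.
have /choice[c' c'E] a : exists q : {poly K},
    forall t, q.[t] = Phi [ffun j => (c j).[t]] a.
  exact: pfun_curve c (pPhi a).
by exists c' => t; apply/ffunP => a; rewrite ffunE.
Qed.

(** Suppose that [B] misses [a], that [C] misses [b] and that they cover [A]. Forms separating the
    two points pull back to nonzero polynomials along the curve, and at a common nonroot of these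
    and [h] the curve is in [A] but in neither set. The polynomial [h] lets the curve leave [A] at
    finitely many parameters. *)
Lemma irr_curves A : A !=set0 -> A `<=` @proj_space K I ->
  (forall a b, A a -> A b -> exists (c : I -> {poly K}) (h : {poly K}),
     [/\ h != 0, curve_at c 0 = a, curve_at c 1 = b
       & forall t, h.[t] != 0 -> A (curve_at c t)]) ->
  irreducible A.
Proof.
move=> An0 A0 Acurve; split=> // B C cB cC ABC.
apply: contrapT => /not_orP[/nonsubset[a [Aa nBa]] /nonsubset[b [Ab nCb]]].
have [e [f [ff fB fa]]] := zclosed_sep cB (A0 _ Aa) nBa.
have [e' [g [gf gC gb]]] := zclosed_sep cC (A0 _ Ab) nCb.
have [c [h [h0 ca cb cA]]] := Acurve a b Aa Ab.
have [qf qfE] := pfun_curve c (isform_pfun ff); have [qg qgE] := pfun_curve c (isform_pfun gf).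
have qf0 : qf != 0.
  by apply: contra_neq fa => q0; rewrite -ca -qfE q0 horner0.
have qg0 : qg != 0.
  by apply: contra_neq gb => q0; rewrite -cb -qgE q0 horner0.
have [t] := nonroot_exists (mulf_neq0 h0 (mulf_neq0 qf0 qg0)).
rewrite !hornerM !mulf_eq0 !negb_or qfE qgE => /and3P[ht ft gt].
by have [/fB/eqP|/gC/eqP] := ABC _ (cA t ht); apply/negP.
Qed.

Definition segment (J : finType) (s s' : {ffun J -> K}) (j : J) : {poly K} :=
  (s j)%:P + (s' j - s j) *: 'X.

Lemma segment_at (J : finType) (s s' : {ffun J -> K}) t :
  [ffun j => (segment s s' j).[t]] = [ffun j => (1 - t) * s j + t * s' j].
Proof. by apply/ffunP => j; rewrite !ffunE /segment !hornerE; ring. Qed.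

(** The curve is the image of a segment in the parameter space. [Phi] may vanish along it, where it
    gives no projective point; a coordinate of the curve that is nonzero at the start serves as the
    polynomial [h] of [irr_curves]. *)
Lemma irr_image (J : finType) (Phi : {ffun J -> K} -> {ffun I -> K})
    (D : set {ffun J -> K}) A :
  A !=set0 -> A `<=` @proj_space K I -> (forall a, pfun (fun s => Phi s a)) ->
  (forall s s' t, D s -> D s' -> D [ffun j => (1 - t) * s j + t * s' j]) ->
  (forall x, A x -> exists2 s, D s & x = Phi s) ->
  (forall s, D s -> Phi s != 0 -> A (Phi s)) ->
  irreducible A.
Proof.
move=> An0 A0 pPhi Dconv APhi PhiA; apply: irr_curves => // a b Aa Ab.
have [s Ds aE] := APhi a Aa; have [s' Ds' bE] := APhi b Ab.
have [c cE] := curve_comp (segment s s') pPhi.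
have [k ak] : exists k, a k != 0.
  apply: contrapT => /forallNP a0; case/eqP: (A0 a Aa).
  by apply/ffunP => k; rewrite ffunE; apply/eqP/negPn/negP/a0.
have ca : curve_at c 0 = a.
  rewrite cE segment_at aE; congr Phi; apply/ffunP => j.
  by rewrite ffunE subr0 mul1r mul0r addr0.
exists c, (c k); split=> //.
- apply: contra_neq ak => ck; move: ca => /ffunP/(_ k).
  by rewrite ffunE ck horner0.
- rewrite cE segment_at bE; congr Phi; apply/ffunP => j.
  by rewrite ffunE subrr mul0r add0r mul1r.
move=> t ckt; rewrite cE segment_at; apply: PhiA; first exact: Dconv.
apply: contra_neq ckt => P0; have /ffunP/(_ k) := cE t.
by rewrite segment_at P0 !ffunE.
Qed.

End Curves.

(** * Dimension *)

Lemma big_ord_ltS (R : Type) (idx : R) (op : Monoid.com_law idx) m (k : 'I_m)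
    (F : 'I_m -> R) :
  \big[op/idx]_(i < m | (i < k.+1)%N) F i =
  op (F k) (\big[op/idx]_(i < m | (i < k)%N) F i).
Proof.
rewrite (bigD1 k) //=; congr (op _ _); apply: eq_bigl => i.
by rewrite ltnS ltn_neqAle andbC.
Qed.

Section ChainMonomials.
Variables (K : fieldType) (I : finType) (m : nat).
Variables (Z : nat -> set {ffun I -> K}) (a0 : I).
Variables (s : 'I_m -> nat) (f : 'I_m -> {ffun I -> K} -> K).
Hypothesis vZ : forall k, (k <= m)%N -> variety (Z k).
Hypothesis sZ : forall k : 'I_m, Z k `<=` Z k.+1.
Hypothesis ff : forall k, isform (s k) (f k).
Hypothesis f0 : forall (k : 'I_m) x, Z k x -> f k x = 0.
Hypothesis fn0 : forall k : 'I_m, exists2 x, Z k.+1 x & f k x != 0.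
Hypothesis x0 : exists2 x, Z 0%N x & x a0 != 0.

Variable e : nat.
Local Notation E := {ffun 'I_m -> 'I_e.+1}.
Let M := (\sum_k s k * e)%N.

(* The power of the coordinate a0 makes all these monomials of degree M. *)
Definition chain_monomial (j : nat) (a : E) (x : {ffun I -> K}) : K :=
  x a0 ^+ (M - \sum_(k < m | (k < j)%N) s k * a k) *
  \prod_(k < m | (k < j)%N) f k x ^+ a k.

Lemma chain_weight_le j (a : 'I_m -> nat) : (forall k, (a k <= e)%N) ->
  (\sum_(k < m | (k < j)%N) s k * a k <= M)%N.
Proof.
move=> ae; rewrite /M [X in (_ <= X)%N](bigID (fun k : 'I_m => (k < j)%N)) /=.
apply: leq_trans (leq_addr _ _); apply: leq_sum => k _.
by rewrite leq_mul2l ae orbT.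
Qed.

Lemma isform_chain_monomial j a : isform M (chain_monomial j a).
Proof.
have wM := @chain_weight_le j (fun k => a k) (fun k => leq_ord _).
rewrite -(subnK wM); apply: isformM.
  by apply: isformW (mul1n _) _; apply: isformX; apply: isform_coord.
by apply: isform_prod => k _; exact: (isformX (a k) (ff k)).
Qed.

(* Induction on j: a vanishing combination on Z_(j+1) can be divided by the
   smallest power of f_j that occurs in it, and restricting the quotient to Z_j
   leaves the terms with exactly that power. *)
Lemma chain_monomial_free j (c : E -> K) : (j <= m)%N ->
  (forall a b, c a != 0 -> c b != 0 -> forall k : 'I_m, (j <= k)%N -> a k = b k) ->
  (forall x, Z j x -> \sum_a c a * chain_monomial j a x = 0) ->
  forall a, c a = 0.
Proof.
elim: j c => [|j IH] c jm agree czero a1.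
  (* At [j = 0] the exponents agree everywhere, so [c] is supported on [a1] alone, and its monomial
     is a power of [x a0]. *)
  apply/eqP/negPn/negP => ca1; have [x Zx xa0] := x0.
  have := czero x Zx; rewrite (bigD1 a1) //= big1 => [|b ba1]; last first.
    have [->|cb] := eqVneq (c b) 0; first by rewrite mul0r.
    by case/eqP: ba1; apply/ffunP => k; apply: agree.
  rewrite addr0 /chain_monomial [X in _ * (_ * X)]big1 // mulr1 => /eqP.
  by rewrite mulf_eq0 (negPf ca1) expf_eq0 (negPf xa0) andbF.
apply/eqP/negPn/negP => ca1.
pose k0 := Ordinal jm.
have [a2 ca2 min_a2] := @arg_minnP _ a1 (fun a => c a != 0) (fun a => a k0 : nat) ca1.
pose r : nat := a2 k0.
pose w (a : E) := (\sum_(k < m | (k < j)%N) s k * a k)%N.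
pose pr (a : E) (x : {ffun I -> K}) := \prod_(k < m | (k < j)%N) f k x ^+ a k.
(* In [Q] the common factor [f k0 x ^+ r] is replaced by the power [s k0 * r] of [x a0], which has
   the same degree; so the quotient is again a form of degree [M]. *)
pose Q (x : {ffun I -> K}) := \sum_a c a *
  (x a0 ^+ (M - (w a + s k0 * (a k0 - r))) * (f k0 x ^+ (a k0 - r) * pr a x)).
have wM (a : E) : (w a + s k0 * a k0 <= M)%N.
  by have := @chain_weight_le j.+1 (fun k => a k) (fun k => leq_ord _);
    rewrite (big_ord_ltS _ k0) addnC.
have fQ : isform M Q.
  apply: isform_sum => a _; apply: (isformZ (c a)).
  have le : (w a + s k0 * (a k0 - r) <= M)%N.
    by apply: leq_trans (wM a); rewrite leq_add2l leq_mul2l leq_subr orbT.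
  rewrite -[X in isform X](subnK le); apply: isformM.
    by apply: isformW (mul1n _) _; apply: isformX; apply: isform_coord.
  rewrite addnC; apply: isformM; first exact: isformX.
  by apply: isform_prod => k _; exact: (isformX (a k) (ff k)).
have Q0 x : Z j.+1 x -> Q x = 0.
  have [cZ iZ] := vZ jm; move: x.
  apply: (irr_cancel iZ (zclosed_sub_proj cZ) fQ (ff k0) (fn0 k0)) => x Zx fx.
  apply/eqP; rewrite -(mulIr_eq0 _ (mulIf (expf_neq0 r fx))); apply/eqP.
  rewrite -[RHS](mulr0 (x a0 ^+ (s k0 * r))) -(czero x Zx) /Q mulr_suml mulr_sumr.
  apply: eq_bigr => a _; have [->|ca] := eqVneq (c a) 0; first by rewrite !mul0r mulr0.
  have ra : (r <= a k0)%N by apply: min_a2.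
  rewrite /chain_monomial !(big_ord_ltS _ k0) -/(w a) -/(pr a x) /=.
  have -> : (M - (w a + s k0 * (a k0 - r)) = s k0 * r + (M - (s k0 * a k0 + w a)))%N.
    rewrite addnBA; last by rewrite addnC.
    have le : (s k0 * r <= s k0 * a k0)%N by rewrite leq_mul2l ra orbT.
    rewrite mulnBr addnBA // subnBA; last by apply: leq_trans le (leq_addl _ _).
    by rewrite [(w a + _)%N]addnC [(s k0 * r + _)%N]addnC.
  rewrite exprD -[in X in _ = _ * (_ * (_ * (X * _)))](subnK ra) exprD.
  by move: (_ - (s k0 * _ + _))%N => N; ring.
have Qj x : Z j x -> \sum_(a : E) (if a k0 == r :> nat then c a else 0) *
    chain_monomial j a x = 0.
  move=> Zx; rewrite -[RHS](Q0 x (sZ (k := k0) Zx)); apply: eq_bigr => a _.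
  have [->|ca] := eqVneq (c a) 0; first by rewrite if_same !mul0r.
  have [ar|ar] := eqVneq (a k0 : nat) r.
    by rewrite ar subnn muln0 addn0 expr0 mul1r.
  rewrite (f0 (k := k0)) // expr0n subn_eq0 leqNgt ltn_neqAle eq_sym ar min_a2 //=.
  by rewrite !(mul0r, mulr0).
have := IH _ (ltnW jm) _ Qj a2; rewrite eqxx => c0.
case/eqP: ca2; apply: c0 => a b; case: ifP => [/eqP ar ca|]; last by rewrite eqxx.
case: ifP => [/eqP br cb k|]; last by rewrite eqxx.
rewrite leq_eqVlt => /orP[/eqP jk|]; last exact: agree.
have -> : k = k0 by apply: val_inj.
by apply: val_inj; rewrite /= ar br.
Qed.

End ChainMonomials.

Section Dimension.
Variable K : fieldType.

(** Every monomial of degree at most [B] has its exponents in a box of size [B.+1 ^ n]; this crude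
    count is enough. The relation is a vector in the left kernel of the matrix of coefficients. *)
Lemma mpoly_dependent n B (E : finType) (q : E -> {mpoly K[n]}) :
  (forall a, (msize (q a) <= B.+1)%N) -> (B.+1 ^ n < #|E|)%N ->
  exists c : E -> K, (exists a, c a != 0) /\ \sum_a c a *: q a = 0.
Proof.
move=> qB BE.
pose F : finType := {ffun 'I_n -> 'I_B.+1}.
pose mon (b : F) : 'X_{1..n} := [multinom (b k : nat) | k < n].
pose A := \matrix_(i < #|E|, j < #|F|) (q (enum_val i))@_(mon (enum_val j)).
have : kermx A != 0.
  rewrite kermx_eq0 /row_free neq_ltn; apply/orP; left.
  by apply: leq_ltn_trans (rank_leq_col A) _; rewrite card_ffun !card_ord.
case/rowV0Pn => v /sub_kermxP vA v0.
exists (fun a => v 0 (enum_rank a)); split.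
  apply: contrapT => /forallNP cv; case/eqP: v0; apply/rowP => i; rewrite mxE.
  by apply/eqP/negPn/negP; rewrite -[i]enum_valK; apply: cv.
apply/mpolyP => m; rewrite mcoeff0 raddf_sum /=.
under eq_bigr do rewrite mcoeffZ.
have [mB|] := boolP [forall k, m k < B.+1]%N; last first.
  rewrite negb_forall => /existsP[k]; rewrite -leqNgt => Bm.
  rewrite big1 // => a _; rewrite memN_msupp_eq0 ?mulr0 //.
  apply: msize_mdeg_ge; apply: leq_trans (qB a) (leq_trans Bm _).
  by rewrite mdegE (bigD1 k) //= leq_addr.
pose b : F := [ffun k => inord (m k)].
have mE : mon b = m.
  by apply/mnmP => k; rewrite mnmE ffunE inordK //; exact: (forallP mB).
have /rowP/(_ (enum_rank b)) := vA; rewrite !mxE => vAb.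
rewrite -[RHS]vAb (reindex (@enum_rank E)); last first.
  by exists enum_val => ? _; rewrite ?enum_rankK ?enum_valK.
by apply: eq_bigr => a _; rewrite mxE !enum_rankK mE.
Qed.

Lemma exists_coord (I : finType) (x : {ffun I -> K}) :
  x != 0 -> exists a, x a != 0.
Proof.
move=> x0; apply: contrapT => /forallNP xa; case/eqP: x0.
by apply/ffunP => a; rewrite ffunE; apply/eqP/negPn/negP/xa.
Qed.

(* There are (e+1)^(n+1) chain monomials with exponents at most e, but their
   pullbacks to K^n live in a space of dimension O(e^n). *)
Lemma chain_le (I : finType) n (phi : I -> {mpoly K[n]}) (A : set {ffun I -> K}) :
  (forall e g, isform e g -> (forall v, g [ffun a => (phi a).@[v]] = 0) ->
     forall x, A x -> g x = 0) ->
  forall m, variety_chain A m -> (m <= n)%N.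
Proof.
move=> Adom m; rewrite leqNgt; case: ltnP => // nm Am; exfalso.
have {m nm Am}[Z [vZ sZ]] := variety_chain_le nm Am.
have Zn0 k : (k <= n.+1)%N -> Z k `<=` @proj_space K I.
  by move=> /vZ[[cZ _] _]; apply: zclosed_sub_proj.
have [z Zz] : Z 0%N !=set0 by have [[_ []]] := vZ 0%N isT.
have [a0 za0] := exists_coord (Zn0 0%N isT z Zz).
have /choice[sf sfP] (k : 'I_n.+1) :
    exists sf : nat * ({ffun I -> K} -> K), [/\ isform sf.1 sf.2,
      (forall x, Z k x -> sf.2 x = 0) & exists2 x, Z k.+1 x & sf.2 x != 0].
  have [_ /nonsubset[x [Zx nZx]]] := sZ k (ltn_ord k).
  have [cZ _] := (vZ k (ltnW (ltn_ord k))).1.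
  have [e [g [fg gZ gx]]] := zclosed_sep cZ (Zn0 k.+1 (ltn_ord k) x Zx) nZx.
  by exists (e, g); split=> //; exists x.
pose s k := (sf k).1; pose f k := (sf k).2.
pose D := (\max_a msize (phi a))%N; pose S := (\sum_k s k)%N.
(* With [M = S * e] this choice gives [(D * M).+1 ^ n <= ((D * S).+1 * e.+1) ^ n = e * e.+1 ^ n <
   e.+1 ^ n.+1], so there are more monomials than the pullbacks have coefficients. *)
pose e := ((D * S).+1 ^ n)%N; pose M := (\sum_k s k * e)%N.
pose E : finType := {ffun 'I_n.+1 -> 'I_e.+1}.
pose T : E -> {ffun I -> K} -> K := chain_monomial a0 s f n.+1.
have fT a : isform M (T a).
  by apply: isform_chain_monomial => k; have [] := sfP k.
have /choice[q qP] (a : E) : exists q : {mpoly K[n]},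
    (msize q <= (D * M).+1)%N /\ forall v, q.@[v] = T a [ffun i => (phi i).@[v]].
  have [|q ? ?] := isform_comp (D := D) (c := phi) (fT a); last by exists q.
  by move=> i; apply: leqW; apply: leq_bigmax.
have cardE : ((D * M).+1 ^ n < #|E|)%N.
  rewrite card_ffun !card_ord; apply: (@leq_ltn_trans (e * e.+1 ^ n)).
    rewrite {1}/e -expnMn; case: (n) => [//|n']; rewrite leq_exp2r //.
    have -> : M = (S * e)%N by rewrite /M /S big_distrl.
    by rewrite mulnA mulSn mulnS addSn ltnS addnA; apply: leq_addl.
  by rewrite expnS ltn_pmul2r ?expn_gt0.
have [c [[a ca] cq]] := mpoly_dependent (fun a => (qP a).1) cardE.
case/eqP: ca; move: a.
apply: (@chain_monomial_free K I n.+1 Z a0 s f _ _ _ _ _ _ e n.+1) => //.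
- by move=> k /vZ[].
- by move=> k; have [] := sZ k (ltn_ord k).
- by move=> k; have [] := sfP k.
- by move=> k x; have [_ fk _] := sfP k; apply: fk.
- by move=> k; have [] := sfP k.
- by exists z.
- by move=> a b _ _ k; rewrite leqNgt (ltn_ord k).
move=> x /(vZ n.+1 (leqnn _)).2; move: x; apply: (Adom M).
  by apply: isform_sum => a _; apply: isformZ; apply: fT.
move=> v; have := congr1 (fun p => p.@[v]) cq; rewrite meval0 raddf_sum /= => cq0.
rewrite -[RHS]cq0; by apply: eq_bigr => a _; rewrite mevalZ (qP a).2.
Qed.

End Dimension.

Section Charts.
Variable K : fieldType.
Hypothesis K_inf : infinite_set [set: K].
Variables I J : finType.

(** [Phi] reaches the whole affine piece [g = 1]. By homogeneity a form vanishing on the chart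
    vanishes wherever [g] is nonzero, hence on [A], and [chain_le] gives the upper bound. For the
    lower bound, the linear forms [sg] keep the images of the coordinate subspaces apart after
    taking closures. *)
Lemma chart_dim (A : set {ffun I -> K}) (g : {ffun I -> K} -> K)
    (Phi : {ffun J -> K} -> {ffun I -> K}) (sg : J -> {ffun I -> K} -> K) :
  variety A -> isform 1 g -> (exists2 x, A x & g x != 0) ->
  (forall a, pfun (fun t => Phi t a)) -> (forall j, isform 1 (sg j)) ->
  (forall t, A (Phi t)) -> (forall t j, sg j (Phi t) = t j) ->
  (forall x, A x -> g x = 1 -> exists t, x = Phi t) ->
  has_dim A #|J|.
Proof.
move=> [cA iA] fg gn0 pPhi fsg APhi sgPhi chart.
have A0 := zclosed_sub_proj cA.
split; last first.
  have [phi phiP] := choice pPhi.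
  apply: (@chain_le K I #|J| phi) => e f ff fphi.
  apply: (irr_cancel iA A0 ff fg gn0) => x Ax gx.
  have [|t xt] := chart _ (zclosed_scale cA (invr_neq0 gx) Ax).
    by rewrite (isform_scale _ _ fg) expr1 mulVf.
  have := fphi (fun k => t (enum_val k)).
  have -> : [ffun a => (phi a).@[fun k => t (enum_val k)]] = Phi t.
    by apply/ffunP => a; rewrite ffunE -phiP.
  rewrite -xt (isform_scale _ _ ff) => /eqP.
  by rewrite mulf_eq0 expf_eq0 invr_eq0 (negPf gx) andbF => /eqP.
pose D k : set {ffun J -> K} :=
  [set t | forall j, (k <= enum_rank j)%N -> t j = 0].
have PhiA k : Phi @` D k `<=` A by move=> _ [t _ <-].
have Phi0 k : Phi @` D k `<=` @proj_space K I := subset_trans (PhiA k) A0.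
exists (fun k => zclosure (Phi @` D k)); split=> k kJ.
  split; last exact: zclosure_sub.
  apply: variety_closure => //; apply: (irr_image K_inf (D := D k) _ _ pPhi) => //.
  - by exists (Phi 0), 0 => // j _; rewrite ffunE.
  - by move=> s s' t Ds Ds' j kj; rewrite ffunE Ds ?Ds' // !mulr0 addr0.
  - by move=> x [t Dt <-]; exists t.
pose j := enum_val (Ordinal kJ).
split.
  apply: zclosureS => _ [t Dt <-]; exists t => // i ki; apply: Dt.
  exact: ltnW.
(* The unit vector of the parameter that becomes free at stage [k.+1]: the form [sg j] is 1 at its
   image and vanishes on stage [k]. *)
pose t1 : {ffun J -> K} := [ffun i => (i == j)%:R].
move=> /(_ (Phi t1)) sub; have /sub : zclosure (Phi @` D k.+1) (Phi t1).
  apply: sub_zclosure; exists t1 => // i ki; rewrite ffunE; case: eqP => // ij.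
  by move: ki; rewrite ij enum_valK ltnn.
move=> /(zclosureP _ (Phi0 k))[_ Z1]; have := oner_neq0 K.
have -> : 1 = sg j (Phi t1) by rewrite sgPhi ffunE eqxx.
rewrite (Z1 _ _ (fsg j)) ?eqxx // => _ [t Dt <-].
by rewrite sgPhi Dt // enum_valK.
Qed.

End Charts.

Section LinearSubspaces.
Variable K : fieldType.
Hypothesis K_inf : infinite_set [set: K].
Variables I J : finType.
Variables (psi : {ffun J -> K} -> {ffun I -> K}) (sg : J -> {ffun I -> K} -> K).
Hypothesis fpsi : forall a, isform 1 (fun t => psi t a).
Hypothesis fsg : forall j, isform 1 (sg j).
Hypothesis sg_psi : forall t j, sg j (psi t) = t j.

(** The projective linear subspace parametrized by [psi], written as the fixed points of the
    projector that applies [sg] and then [psi]. Equations and parametrization can both be read off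
    this form. *)
Let A : set {ffun I -> K} := [set x | x != 0 /\ x = psi [ffun j => sg j x]].

Let A_psi t : t != 0 -> A (psi t).
Proof.
move=> t0; split; last by congr psi; apply/ffunP => j; rewrite ffunE sg_psi.
apply: contra_neq t0 => psi0; apply/ffunP => j.
by rewrite -(sg_psi t) psi0 ffunE (isform_at0 (fsg j)).
Qed.

Lemma linear_variety : (0 < #|J|)%N -> variety A.
Proof.
case/card_gt0P => j0 _.
have cA : zclosed A.
  have fa (a : I) : isform 1 (fun x => x a - psi [ffun j => sg j x] a).
    apply: isformB; first exact: isform_coord.
    exact: (isform_subst (fpsi a) fsg).
  have := zclosed_forms fa; congr zclosed; rewrite predeqE => x.
  split=> -[x0 xP]; split=> //; last by move=> a; rewrite {1}xP subrr.
  by apply/ffunP => a; apply/eqP; rewrite -subr_eq0 xP.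
split=> //; apply: (@irr_image _ K_inf I J psi setT).
- exists (psi [ffun=> 1]); apply: A_psi; apply/eqP => /ffunP/(_ j0).
  by rewrite !ffunE => /eqP; rewrite oner_eq0.
- exact: zclosed_sub_proj.
- by move=> a; apply: isform_pfun (fpsi a).
- by [].
- by move=> x [_ xE]; exists [ffun j => sg j x].
- move=> t _ pt0; apply: A_psi; apply: contra_neq pt0 => ->.
  by apply/ffunP => a; rewrite ffunE (isform_at0 (fpsi a)).
Qed.

Lemma linear_dim : (0 < #|J|)%N -> has_dim A #|J|.-1.
Proof.
move=> J0; have vA := linear_variety J0; case/card_gt0P: J0 => j0 _.
pose J' : finType := {j | j != j0}.
(* Dehomogenization at [j0]: that parameter is set to 1, which is why the dimension is one less than
   the number of parameters. *)
pose ext (t : {ffun J' -> K}) : {ffun J -> K} := [ffun j => oapp t 1 (insub j)].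
have extE t (j : J') : ext t (val j) = t j by rewrite ffunE valK.
have ext0 t : ext t j0 = 1 by rewrite ffunE insubF // eqxx.
have extn0 t : ext t != 0.
  by apply/eqP => /ffunP/(_ j0); rewrite ext0 ffunE => /eqP; rewrite oner_eq0.
have -> : #|J|.-1 = #|J'|.
  by rewrite card_sig -(cardC1 j0); apply: eq_card => j; rewrite !inE.
apply: (chart_dim K_inf (g := sg j0) (Phi := fun t => psi (ext t))
  (sg := fun j => sg (val j))) => //.
- exists (psi (ext 0)); first exact: A_psi.
  by rewrite sg_psi ext0 oner_eq0.
- move=> a; apply: (pfun_subst (isform_pfun (fpsi a))) => j.
  by case: insub => [u|] /=; [apply: pfun_coord | apply: pfun_cst].
- by move=> t; apply: A_psi.
- by move=> t j; rewrite sg_psi extE.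
move=> x [_ xE] x1; exists [ffun j => sg (val j) x]; rewrite {1}xE.
congr psi; apply/ffunP => j; rewrite !ffunE.
case: insubP => [u _ <- /=|]; first by rewrite ffunE.
by rewrite negbK => /eqP->.
Qed.

End LinearSubspaces.

(** * Pluecker coordinates *)

Section Pluecker.
Variables (K : fieldType) (d : nat).
Local Notation V := {ffun pidx d -> K}.
Local Notation N := 'I_d.+1.
Implicit Types (p q : V) (i j k l : N).

(* The antisymmetric extension of the Pluecker coordinates to all index pairs. *)
Definition aplu p i j : K :=
  if (i < j)%N then plu p i j else if (j < i)%N then - plu p j i else 0.

Lemma aplu_lt p i j : (i < j)%N -> aplu p i j = plu p i j.
Proof. by rewrite /aplu => ->. Qed.

Lemma apluii p i : aplu p i i = 0.
Proof. by rewrite /aplu ltnn. Qed.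

Lemma apluC p i j : aplu p j i = - aplu p i j.
Proof. by rewrite /aplu; case: ltngtP; rewrite ?opprK ?oppr0. Qed.

Lemma plu_val p (a : pidx d) : plu p (val a).1 (val a).2 = p a.
Proof. by rewrite /plu -surjective_pairing valK. Qed.

Lemma aplu_val p (a : pidx d) : p a = aplu p (val a).1 (val a).2.
Proof. by rewrite aplu_lt ?plu_val //; exact: (valP a). Qed.

Lemma dirvecE p i : dirvec p i = aplu p ord0 i.
Proof.
rewrite /aplu ltn0; case: ltnP => // i0.
by rewrite /dirvec /plu insubF //= ltnNge i0.
Qed.

Lemma aplu_inj p q : (forall i j, aplu p i j = aplu q i j) -> p = q.
Proof. by move=> pq; apply/ffunP => a; rewrite !aplu_val. Qed.

Lemma aplu_eq0 p : (forall i j, aplu p i j = 0) -> p = 0.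
Proof. by move=> pq; apply/ffunP => a; rewrite aplu_val ffunE. Qed.

Lemma aplu_neq0 p i j : aplu p i j != 0 -> p != 0.
Proof.
apply: contra_neq => ->; rewrite /aplu /plu.
by case: ltnP => _; [|case: ltnP => _ //]; case: insub => [a|] /=;
  rewrite ?ffunE ?oppr0.
Qed.

Lemma isform_plu i j : @isform K (pidx d) 1 (fun p => plu p i j).
Proof.
rewrite /plu; case: insub => [a|] /=; [exact: isform_coord | exact: isform0].
Qed.

Lemma isform_aplu i j : @isform K (pidx d) 1 (fun p => aplu p i j).
Proof.
rewrite /aplu; case: ltnP => _; first exact: isform_plu.
case: ltnP => _; [apply: isformN; exact: isform_plu | exact: isform0].
Qed.

Lemma isform_dirvec i : @isform K (pidx d) 1 (fun p => dirvec p i).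
Proof. exact: isform_plu. Qed.

Definition mkplu (f : N -> N -> K) : V := [ffun a => f (val a).1 (val a).2].

Lemma plu_mkplu f i j : (i < j)%N -> plu (mkplu f) i j = f i j.
Proof. by move=> ij; rewrite /plu insubT //= ffunE SubK. Qed.

Lemma aplu_mkplu f i j : (forall i, f i i = 0) ->
  (forall i j, f j i = - f i j) -> aplu (mkplu f) i j = f i j.
Proof.
move=> f0 fC; rewrite /aplu; case: ltngtP => ij; first by rewrite plu_mkplu.
  by rewrite plu_mkplu // -fC.
by rewrite (ord_inj ij) f0.
Qed.

Definition plucker p i j k l : K :=
  aplu p i j * aplu p k l - aplu p i k * aplu p j l + aplu p i l * aplu p j k.

(** [plucker] changes sign under transpositions and vanishes identically when neighbouring indices
    coincide, so the relations for increasing indices imply all. The auxiliary facts [sort0] to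
    [sort4] drop the order assumptions step by step. *)
Lemma grassmannianP p : grassmannian p <->
  p != 0 /\ forall i j k l, plucker p i j k l = 0.
Proof.
split=> -[p0 pG]; split=> //; last first.
  move=> i j k l ij jk kl; have ik := ltn_trans ij jk.
  have jl := ltn_trans jk kl; have il := ltn_trans ij jl.
  by have := pG i j k l; rewrite /plucker !aplu_lt.
have sw12 i j k l : plucker p j i k l = - plucker p i j k l.
  by rewrite /plucker (apluC p i j); ring.
have sw23 i j k l : plucker p i k j l = - plucker p i j k l.
  by rewrite /plucker (apluC p j k); ring.
have sw34 i j k l : plucker p i j l k = - plucker p i j k l.
  by rewrite /plucker (apluC p k l); ring.
have sort0 i j k l : (i <= j)%N -> (j <= k)%N -> (k <= l)%N ->
    plucker p i j k l = 0.
  rewrite leq_eqVlt => /orP[/eqP/ord_inj-> _ _|ij].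
    by rewrite /plucker apluii; ring.
  rewrite leq_eqVlt => /orP[/eqP/ord_inj-> _|jk].
    by rewrite /plucker apluii; ring.
  rewrite leq_eqVlt => /orP[/eqP/ord_inj->|kl].
    by rewrite /plucker apluii; ring.
  have ik := ltn_trans ij jk; have jl := ltn_trans jk kl.
  have il := ltn_trans ij jl.
  by rewrite /plucker !aplu_lt // pG.
have sort1 i j k l : (i <= j)%N -> (i <= k)%N -> (j <= l)%N -> (k <= l)%N ->
    plucker p i j k l = 0.
  move=> ij ik jl kl; case: (leqP j k) => [jk|/ltnW kj]; first exact: sort0.
  by apply/eqP; rewrite -oppr_eq0 -sw23 sort0.
have sort2 i j k l : (i <= j)%N -> (i <= k)%N -> (k <= l)%N ->
    plucker p i j k l = 0.
  move=> ij ik kl; case: (leqP j l) => [jl|/ltnW lj]; first exact: sort1.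
  rewrite -[LHS]opprK -sw34 -[X in - X]opprK -sw23 -[X in - - X]opprK -sw34.
  by rewrite sort1 ?oppr0 // ?(leq_trans kl) ?(leq_trans ik).
have sort3 i j k l : (i <= j)%N -> (k <= l)%N -> plucker p i j k l = 0.
  move=> ij kl; case: (leqP i k) => [ik|/ltnW ki]; first exact: sort2.
  rewrite -[RHS](sort2 k l i j kl ki ij) /plucker.
  by rewrite (apluC p k i) (apluC p l j) (apluC p k j) (apluC p l i); ring.
have sort4 i j k l : (i <= j)%N -> plucker p i j k l = 0.
  move=> ij; case: (leqP k l) => [kl|/ltnW lk]; first exact: sort3.
  by apply/eqP; rewrite -oppr_eq0 -sw34 sort3.
move=> i j k l; case: (leqP i j) => [ij|/ltnW ji]; first exact: sort4.
by apply/eqP; rewrite -oppr_eq0 -sw12 sort4.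
Qed.

(** The relation is alternating in its three indices, so it holds for all positive ones. It is
    solved for [aplu q j k] to show that, for any fixed [i], these coordinates are differences of
    the numbers [aplu q i l]. *)
Lemma LGP q : LG q <-> q != 0 /\ forall i j k,
  (0 < i)%N -> (0 < j)%N -> (0 < k)%N -> aplu q j k = aplu q i k - aplu q i j.
Proof.
split=> -[q0 qL]; split=> //; last first.
  move=> i j k i0 ij jk; have ik := ltn_trans ij jk.
  rewrite -!aplu_lt // (qL i j k) ?(leq_trans i0) ?(ltnW ij) ?(ltnW ik) //.
  by ring.
pose R i j k := aplu q j k - aplu q i k + aplu q i j.
suff R0 i j k : (0 < i)%N -> (0 < j)%N -> (0 < k)%N -> R i j k = 0.
  move=> i j k i0 j0 k0; apply/eqP; rewrite -subr_eq0; apply/eqP.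
  by rewrite -[RHS](R0 i j k i0 j0 k0) /R; ring.
have sw12 a b c : R b a c = - R a b c by rewrite /R (apluC q a b); ring.
have sw23 a b c : R a c b = - R a b c by rewrite /R (apluC q b c); ring.
have sort0 (a b c : N) : (0 < a)%N -> (a <= b)%N -> (b <= c)%N -> R a b c = 0.
  move=> a0; rewrite leq_eqVlt => /orP[/eqP/ord_inj-> _|ab].
    by rewrite /R apluii; ring.
  rewrite leq_eqVlt => /orP[/eqP/ord_inj->|bc].
    by rewrite /R apluii; ring.
  by rewrite /R !aplu_lt ?qL // (ltn_trans ab).
have sort1 (a b c : N) : (0 < a)%N -> (a <= b)%N -> (a <= c)%N -> R a b c = 0.
  move=> a0 ab ac; case: (leqP b c) => [bc|/ltnW cb]; first exact: sort0.
  by apply/eqP; rewrite -oppr_eq0 -sw23 sort0.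
move=> i0 j0 k0; case: (leqP i j) => [ij|/ltnW ji].
  case: (leqP i k) => [ik|/ltnW ki]; first exact: sort1.
  rewrite -[LHS]opprK -sw23 -sw12; apply: sort1 => //.
  exact: leq_trans ij.
case: (leqP j k) => [jk|/ltnW kj].
  by apply/eqP; rewrite -oppr_eq0 -sw12 sort1.
have ki := leq_trans kj ji.
by rewrite -[LHS]opprK -sw12 -[X in - X]opprK -sw23 -[X in - - X]opprK -sw12 sort1 ?oppr0.
Qed.

Lemma plu_cremona p i j : (i < j)%N -> plu (cremona p) i j =
  if i == ord0 then (dirvec p j)^-1 else plu p i j / (dirvec p i * dirvec p j).
Proof.
by move=> ij; rewrite {1}/plu insubT //= ffunE SubK.
Qed.

Lemma aplu_cremona0 p i : aplu (cremona p) ord0 i = (dirvec p i)^-1.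
Proof.
rewrite /aplu ltn0; case: ltnP => i0; first by rewrite plu_cremona.
(* For the index 0 both sides vanish: the diagonal entry is 0, and the inverse of 0 is 0 by
   convention. *)
have -> : i = ord0 by apply: ord_inj; apply/eqP; rewrite -leqn0.
by rewrite dirvecE apluii invr0.
Qed.

Lemma aplu_cremona p i j : (0 < i)%N -> (0 < j)%N ->
  aplu (cremona p) i j = aplu p i j / (dirvec p i * dirvec p j).
Proof.
have n0 k : (0 < k)%N -> (k == ord0) = false.
  by move=> k0; apply/negP => /eqP E; rewrite E in k0.
move=> i0 j0; rewrite /aplu; case: ltngtP => ij; rewrite ?mul0r //.
  by rewrite plu_cremona // n0.
by rewrite plu_cremona // n0 // mulNr (mulrC (dirvec p i)).
Qed.

Lemma cremonaK p : torus p -> torus (cremona p) /\ cremona (cremona p) = p.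
Proof.
move=> Up; split=> [i i0|].
  by rewrite dirvecE aplu_cremona0 invr_eq0 Up.
apply: aplu_inj => i j.
have dv k : dirvec (cremona p) k = (dirvec p k)^-1.
  by rewrite dirvecE aplu_cremona0.
have [i0|] := posnP i.
  have -> : i = ord0 by apply: ord_inj.
  by rewrite aplu_cremona0 dv invrK dirvecE.
have [j0|j0 i0] := posnP j.
  have -> : j = ord0 by apply: ord_inj.
  by rewrite apluC aplu_cremona0 dv invrK dirvecE -apluC.
rewrite !aplu_cremona // !dv -invfM invrK -mulrA mulVf ?mulr1 //.
by rewrite mulf_neq0 ?Up.
Qed.

(** The line through two points of projective space, by its 2 x 2 minors. With [x ord0 = 1] and
    [v ord0 = 0] it is the affine line through [x] with direction [v]. *)
Definition wedge (x v : N -> K) : V := mkplu (fun i j => x i * v j - x j * v i).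

Lemma aplu_wedge x v i j : aplu (wedge x v) i j = x i * v j - x j * v i.
Proof. by apply: aplu_mkplu => *; ring. Qed.

Lemma wedge_grassmannian x v : wedge x v != 0 -> grassmannian (wedge x v).
Proof.
move=> w0; apply/grassmannianP; split=> // i j k l.
by rewrite /plucker !aplu_wedge; ring.
Qed.

(** The rows [a] and [b] of the antisymmetric matrix of [p] are the points where the line meets the
    coordinate hyperplanes [a] and [b]. They span it by the Pluecker relation with indices [a], [b],
    [i], [j]. *)
Lemma wedge_decomp p a b : grassmannian p -> aplu p a b != 0 ->
  p = wedge (fun l => - aplu p b l / aplu p a b) (fun l => aplu p a l).
Proof.
move=> /grassmannianP[_ pG] ab; apply: aplu_inj => i j.
rewrite aplu_wedge; apply: (mulfI ab).
have := pG a b i j; rewrite /plucker => /eqP; rewrite addrAC subr_eq0 => /eqP E.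
rewrite mulrBr !mulrA [aplu p a b * _ / _]mulrAC mulfV // mul1r.
rewrite [aplu p a b * - aplu p b j / _]mulrAC mulfV // mul1r.
by rewrite -[LHS](addrK (aplu p a j * aplu p b i)) E; ring.
Qed.

End Pluecker.

(** * Varieties with linear parameters: coordinate subspaces, sections of LG(d), families of
    lines *)

Section CoordinateSubspaces.
Variables (K : fieldType) (I : finType).
Hypothesis K_inf : infinite_set [set: K].

Definition coord_subspace (S : {set I}) : set {ffun I -> K} :=
  [set x : {ffun I -> K} | x != 0 /\ forall a, a \in S -> x a = 0].

Definition extend0 (P : pred I) (t : {a | P a} -> K) (a : I) : K :=
  oapp t 0 (insub a).

Lemma extend0_val (P : pred I) (t : {a | P a} -> K) (j : {a | P a}) : extend0 t (val j) = t j.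
Proof. by rewrite /extend0 valK. Qed.

Lemma extend0_out (P : pred I) (t : {a | P a} -> K) a : ~~ P a -> extend0 t a = 0.
Proof. by move=> Pa; rewrite /extend0 insubF //; apply: negbTE. Qed.

Lemma extend0P (P : pred I) (f : I -> K) a : (~~ P a -> f a = 0) ->
  extend0 (fun j : {a | P a} => f (val j)) a = f a.
Proof.
rewrite /extend0; case: insubP => [u _ <- //|Pa fa]; by rewrite fa.
Qed.

Lemma coord_subspace_variety_dim (S : {set I}) : (0 < #|~: S|)%N ->
  variety (coord_subspace S) /\ has_dim (coord_subspace S) #|~: S|.-1.
Proof.
pose J : finType := {a | a \in ~: S}.
pose psi (t : {ffun J -> K}) : {ffun I -> K} := [ffun a => extend0 t a].
pose sg (j : J) (x : {ffun I -> K}) := x (val j).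
have fpsi a : isform 1 (fun t => psi t a).
  apply: (isform_ext (g := fun t => extend0 t a)) => [t|]; first by rewrite ffunE.
  rewrite /extend0; case: insub => [u|] /=; [exact: isform_coord|exact: isform0].
have fsg j : isform 1 (sg j) by apply: isform_coord.
have sgK t j : sg j (psi t) = t j by rewrite /sg ffunE extend0_val.
have -> : coord_subspace S = [set x : {ffun I -> K} | x != 0 /\ x = psi [ffun j => sg j x]].
  rewrite predeqE => x; split=> -[x0 xS]; split=> //.
    apply/ffunP => a; rewrite ffunE.
    transitivity (extend0 (fun j : J => x (val j)) a); last first.
      by rewrite /extend0; case: insub => //= u; rewrite ffunE.
    by rewrite (extend0P (f := x)) // inE negbK; apply: xS.
  by move=> a aS; rewrite xS ffunE extend0_out // inE negbK.
have -> : #|~: S| = #|J| by rewrite card_sig; apply: eq_card => a; rewrite !inE.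
by move=> J0; split; [apply: linear_variety | apply: linear_dim].
Qed.

End CoordinateSubspaces.

Section Families.
Variables (K : fieldType) (d : nat).
Hypothesis K_inf : infinite_set [set: K].
Local Notation V := {ffun pidx d -> K}.
Local Notation N := 'I_d.+1.
Implicit Types (p q : V) (i j k l m : N) (S T : {set N}).

(* On LG(d) one has q_kl = u_l - u_k for k, l > 0, where u_l := q_ml; so q_0l and
   u_l (l <> m) are linear coordinates and LGsub is a coordinate subspace. *)
Definition LGsub S T m : set V := [set q | [/\ LG q,
  forall l, (0 < l)%N -> l \notin S -> aplu q ord0 l = 0 &
  forall l, (0 < l)%N -> l \notin T -> aplu q m l = 0]].

Lemma LGsub_variety_dim S T m : ord0 \notin S -> ord0 \notin T ->
  m \notin T -> (0 < m)%N -> (0 < #|S| + #|T|)%N ->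
  variety (LGsub S T m) /\ has_dim (LGsub S T m) (#|S| + #|T|).-1.
Proof.
move=> S0 T0 Tm m0.
pose J : finType := ({l | l \in S} + {l | l \in T})%type.
pose tS (t : {ffun J -> K}) := extend0 (fun j : {l | l \in S} => t (inl j)).
pose u (t : {ffun J -> K}) := extend0 (fun j : {l | l \in T} => t (inr j)).
pose psi0 (t : {ffun J -> K}) i j :=
  if i == ord0 then (if j == ord0 then 0 else tS t j) else
  if j == ord0 then - tS t i else u t j - u t i.
pose psi t : V := mkplu (psi0 t).
pose sg (j : J) (q : V) :=
  match j with inl l => aplu q ord0 (val l) | inr l => aplu q m (val l) end.
have n0 k : (0 < k)%N -> (k == ord0) = false.
  by move=> k0; apply/negP => /eqP E; rewrite E in k0.
have inn0 (A : {set N}) k : ord0 \notin A -> k \in A -> (0 < k)%N.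
  by move=> A0 kA; rewrite lt0n; apply: contraNneq A0 => /(@ord_inj _ k ord0) <-.
have psiE t i j : aplu (psi t) i j = psi0 t i j.
  apply: aplu_mkplu => [k|k l]; rewrite /psi0; first by case: eqP => // _; rewrite subrr.
  by case: eqP => _; case: eqP => _; rewrite ?oppr0 ?opprK ?opprB.
have fpsi a : isform 1 (fun t => psi t a).
  apply: (isform_ext (g := fun t => psi0 t (val a).1 (val a).2)) => [t|].
    by rewrite aplu_val psiE.
  have ft l : isform 1 (fun t => tS t l).
    by rewrite /tS /extend0; case: insub => [v|] /=; [exact: isform_coord|exact: isform0].
  have fu l : isform 1 (fun t => u t l).
    by rewrite /u /extend0; case: insub => [v|] /=; [exact: isform_coord|exact: isform0].
  rewrite /psi0; case: eqP => _; case: eqP => _; first exact: isform0.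
  - exact: ft.
  - by apply: isformN; apply: ft.
  - by apply: isformB; apply: fu.
have fsg (j : J) : isform 1 (sg j) by case: j => l; apply: isform_aplu.
have um t : u t m = 0 by rewrite /u extend0_out.
have sgK t (j : J) : sg j (psi t) = t j.
  case: j => [[l lS]|[l lT]]; rewrite /= psiE /psi0.
    by rewrite eqxx n0 ?(inn0 _ _ S0 lS) // /tS (extend0_val _ (exist _ l lS)).
  have l0 := inn0 _ _ T0 lT.
  by rewrite !n0 // um subr0 /u (extend0_val _ (exist _ l lT)).
have -> : LGsub S T m = [set x : V | x != 0 /\ x = psi [ffun j => sg j x]].
  rewrite predeqE => q; split=> [[/LGP[q0 qL] qS qT]|[q0 qE]].
    split=> //; apply: aplu_inj => i j; rewrite psiE /psi0.
    have tSE l : (0 < l)%N -> tS [ffun j => sg j q] l = aplu q ord0 l.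
      move=> l0; transitivity
        (extend0 (fun j : {l | l \in S} => aplu q ord0 (val j)) l).
        by rewrite /tS /extend0; case: insub => //= v; rewrite ffunE.
      by rewrite (extend0P (f := aplu q ord0)) // => lS; apply: qS.
    have uE l : (0 < l)%N -> u [ffun j => sg j q] l = aplu q m l.
      move=> l0; transitivity
        (extend0 (fun j : {l | l \in T} => aplu q m (val j)) l).
        by rewrite /u /extend0; case: insub => //= v; rewrite ffunE.
      by rewrite (extend0P (f := aplu q m)) // => lT; apply: qT.
    have [i0|i0] := posnP i.
      rewrite (ord_inj (i0 : i = ord0 :> nat)) eqxx.
      have [j0|j0] := posnP j.
        by rewrite (ord_inj (j0 : j = ord0 :> nat)) eqxx apluii.
      by rewrite n0 // tSE.
    rewrite n0 //; have [j0|j0] := posnP j.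
      by rewrite (ord_inj (j0 : j = ord0 :> nat)) eqxx tSE // -apluC.
    by rewrite n0 // !uE // (qL m i j).
  split.
  - apply/LGP; split=> // i j k i0 j0 k0; rewrite qE !psiE /psi0 !n0 //.
    by ring.
  - by move=> l l0 lS; rewrite qE psiE /psi0 eqxx n0 // /tS extend0_out.
  - move=> l l0 lT; rewrite qE psiE /psi0 !n0 // um subr0.
    by rewrite /u extend0_out.
have -> : (#|S| + #|T|)%N = #|J|.
  by rewrite card_sum !card_sig; congr (_ + _)%N; apply: eq_card => a; rewrite !inE.
by move=> J0; split; [apply: linear_variety | apply: linear_dim].
Qed.

(** Lines joining a point supported on [S] to a point supported on [T]. The pairs form a linear
    space and reach every line of the family, which a chart does not; this is the source of
    irreducibility on G(1,d). *)
Definition Wset S T : set V := [set p : V | p != 0 /\ exists x v : N -> K,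
  [/\ forall l, l \notin S -> x l = 0, forall l, l \notin T -> v l = 0
    & p = wedge x v]].

Lemma Wset_grassmannian S T : Wset S T `<=` @grassmannian K d.
Proof. by move=> p [p0 [x [v [_ _ pE]]]]; rewrite pE in p0 *; apply: wedge_grassmannian. Qed.

Lemma Wset_irreducible S T : Wset S T !=set0 -> irreducible (Wset S T).
Proof.
move=> Wn0.
pose J : finType := (N + N)%type.
pose Phi (s : {ffun J -> K}) : V := wedge (s \o inl) (s \o inr).
pose D : set {ffun J -> K} := [set s | (forall l, l \notin S -> s (inl l) = 0) /\
  forall l, l \notin T -> s (inr l) = 0].
apply: (@irr_image _ K_inf _ _ Phi D) => //.
- by move=> x [].
- move=> a; have pc (j : J) := @pfun_coord K J j.
  have := pfunB (pfunM (pc (inl (val a).1)) (pc (inr (val a).2)))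
    (pfunM (pc (inl (val a).2)) (pc (inr (val a).1))).
  by case=> f fE; exists f => x; rewrite fE aplu_val aplu_wedge.
- move=> s s' t [sS sT] [sS' sT']; split=> l lP; rewrite ffunE.
    by rewrite sS // sS' // !mulr0 addr0.
  by rewrite sT // sT' // !mulr0 addr0.
- move=> p [p0 [x [v [xS vT pE]]]].
  exists [ffun j => match j with inl l => x l | inr l => v l end].
    by split=> l lP; rewrite ffunE ?xS ?vT.
  by rewrite pE; apply: aplu_inj => i j; rewrite !aplu_wedge /= !ffunE.
- by move=> s [sS sT] s0; split=> //; exists (s \o inl), (s \o inr).
Qed.

(* A line with p_ab <> 0 is spanned by a unique pair x, v with x_a = v_b = 1 and
   x_b = v_a = 0; the other entries of x and v are affine coordinates, equal to
   minors of the line. *)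
Lemma wedge_chart (A : set V) S T a b : variety A -> A `<=` @grassmannian K d ->
  a != b -> a \notin S -> b \notin S -> a \notin T -> b \notin T ->
  (forall x v : N -> K, x a = 1 -> x b = 0 -> v a = 0 -> v b = 1 ->
     (forall l, l != a -> l \notin S -> x l = 0) ->
     (forall l, l != b -> l \notin T -> v l = 0) -> A (wedge x v)) ->
  (forall p, A p -> aplu p a b = 1 ->
     (forall l, l != a -> l \notin S -> aplu p b l = 0) /\
     (forall l, l != b -> l \notin T -> aplu p a l = 0)) ->
  has_dim A (#|S| + #|T|).
Proof.
move=> vA AG ab aS bS aT bT wA Aw.
have ba : b != a by rewrite eq_sym.
pose J : finType := ({l | l \in S} + {l | l \in T})%type.
pose x (t : {ffun J -> K}) l :=
  if l == a then 1 else extend0 (fun j : {l | l \in S} => t (inl j)) l.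
pose v (t : {ffun J -> K}) l :=
  if l == b then 1 else extend0 (fun j : {l | l \in T} => t (inr j)) l.
pose Phi t : V := wedge (x t) (v t).
pose sg (j : J) (q : V) :=
  match j with inl l => - aplu q b (val l) | inr l => aplu q a (val l) end.
have xa t : x t a = 1 by rewrite /x eqxx.
have xb t : x t b = 0 by rewrite /x (negPf ba) extend0_out.
have va t : v t a = 0 by rewrite /v (negPf ab) extend0_out.
have vb t : v t b = 1 by rewrite /v eqxx.
have APhi t : A (Phi t).
  apply: wA => // l la lS; first by rewrite /x (negPf la) extend0_out.
  by rewrite /v (negPf la) extend0_out.
have -> : (#|S| + #|T|)%N = #|J|.
  by rewrite card_sum !card_sig; congr (_ + _)%N; apply: eq_card => l; rewrite !inE.
apply: (chart_dim K_inf (g := fun p => aplu p a b) (Phi := Phi) (sg := sg)) => //.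
- exact: isform_aplu.
- by exists (Phi 0) => //; rewrite aplu_wedge xa xb va vb mulr1 mulr0 subr0 oner_eq0.
- move=> c; have px l : pfun (fun t => x t l).
    rewrite /x; case: eqP => _; first exact: pfun_cst.
    by rewrite /extend0; case: insub => [w|] /=; [exact: pfun_coord|exact: pfun_cst].
  have pv l : pfun (fun t => v t l).
    rewrite /v; case: eqP => _; first exact: pfun_cst.
    by rewrite /extend0; case: insub => [w|] /=; [exact: pfun_coord|exact: pfun_cst].
  have := pfunB (pfunM (px (val c).1) (pv (val c).2))
    (pfunM (px (val c).2) (pv (val c).1)).
  by case=> f fE; exists f => t; rewrite fE aplu_val aplu_wedge.
- by case=> l; [apply: isformN|]; apply: isform_aplu.
- move=> t [[l lS]|[l lT]]; rewrite /= aplu_wedge.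
    have la : l != a by apply: contraNneq aS => <-.
    rewrite xb mul0r vb mulr1 sub0r opprK /x (negPf la).
    exact: (extend0_val _ (exist _ l lS)).
  have lb : l != b by apply: contraNneq bT => <-.
  rewrite xa va mulr0 mul1r subr0 /v (negPf lb).
  exact: (extend0_val _ (exist _ l lT)).
move=> p Ap pab; have [pS pT] := Aw p Ap pab.
exists [ffun j => sg j p].
rewrite {1}(wedge_decomp (AG p Ap) (a := a) (b := b)) pab ?oner_neq0 //.
have xE l : x [ffun j => sg j p] l = - aplu p b l.
  rewrite /x; case: eqP => [->|/eqP la]; first by rewrite -apluC pab.
  transitivity (extend0 (fun j : {l | l \in S} => - aplu p b (val j)) l).
    by rewrite /extend0; case: insub => //= w; rewrite ffunE.
  by rewrite (extend0P (f := fun l => - aplu p b l)) // => lS; rewrite pS ?oppr0.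
have vE l : v [ffun j => sg j p] l = aplu p a l.
  rewrite /v; case: eqP => [->//|/eqP la].
  transitivity (extend0 (fun j : {l | l \in T} => aplu p a (val j)) l).
    by rewrite /extend0; case: insub => //= w; rewrite ffunE.
  by rewrite (extend0P (f := aplu p a)) // => lS; rewrite pT.
by apply: aplu_inj => i j; rewrite !aplu_wedge !xE !vE divr1 divr1.
Qed.

End Families.

(** * Representations of the Cremona transformation *)

Section CremonaForms.
Variables (K : fieldType) (d : nat).
Hypothesis d2 : (1 < d)%N.
Local Notation V := {ffun pidx d -> K}.
Local Notation N := 'I_d.+1.
Local Notation U := (@torus K d).
Local Notation C := (@cremona K d).
Implicit Types (p q x : V) (i j k l m : N).

Lemma ord_gt0 i : (0 < i)%N = (i != ord0).
Proof. by rewrite lt0n. Qed.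

(* The tuple representing the Cremona transformation after clearing denominators:
   the product of all p_0k times the coordinate q_ij. *)
Definition cremona_form i j (x : V) : K :=
  (if i == ord0 then 1 else aplu x i j) *
  \prod_(k | k \notin [set ord0; i; j]%SET) dirvec x k.

(** For [i = ord0] the set of omitted indices collapses to two elements and leaves d - 1 linear
    factors. Otherwise d - 2 factors remain, and [aplu x i j] makes up the degree. *)
Lemma isform_cremona_form i j : (i < j)%N -> isform d.-1 (cremona_form i j).
Proof.
move=> ij; have j0 : j != ord0 by rewrite -ord_gt0 (leq_ltn_trans _ ij).
have fprod : isform #|~: [set ord0; i; j]%SET|
    (fun x => \prod_(k | k \notin [set ord0; i; j]%SET) dirvec x k).
  have -> : #|~: [set ord0; i; j]%SET| = (\sum_(k | k \notin [set ord0; i; j]%SET) 1)%N.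
    by rewrite sum1dep_card; apply: eq_card => k; rewrite !inE.
  by apply: isform_prod => k _; apply: isform_dirvec.
have cardC := cardsC [set ord0; i; j]%SET; rewrite card_ord in cardC.
have ji : j != i by rewrite neq_ltn ij orbT.
have [i0|i0] := eqVneq i ord0.
  apply: (isform_ext (g := fun x => 1 * \prod_(k | k \notin [set ord0; i; j]%SET) dirvec x k)).
    by move=> x; rewrite /cremona_form i0 eqxx.
  apply: (@isformW K _ (0 + #|~: [set ord0; i; j]%SET|)%N).
    rewrite i0 in cardC *; rewrite finset.setUid in cardC *.
    by move: cardC; rewrite cards2 eq_sym j0 => -[/(congr1 predn)].
  by apply: isformM fprod; apply: isform_cst.
apply: (isform_ext (g := fun x => aplu x i j * \prod_(k | k \notin [set ord0; i; j]%SET) dirvec x k)).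
  by move=> x; rewrite /cremona_form (negPf i0).
apply: (@isformW K _ (1 + #|~: [set ord0; i; j]%SET|)%N).
  move: cardC; rewrite -finset.setUA cardsU1 !inE cards2.
  rewrite eq_sym (negPf i0) eq_sym (negPf j0) /= eq_sym ji.
  by move=> [/(congr1 predn)].
by apply: isformM fprod; apply: isform_aplu.
Qed.

Lemma cremona_formE i j x : U x -> (i < j)%N ->
  cremona_form i j x = (\prod_(k | k != ord0) dirvec x k) * aplu (C x) i j.
Proof.
move=> Ux ij; have j0 : j != ord0 by rewrite -ord_gt0 (leq_ltn_trans _ ij).
have ji : j != i by rewrite neq_ltn ij orbT.
have dvj : dirvec x j != 0 by apply: Ux; rewrite ord_gt0.
rewrite /cremona_form [X in _ = X * _](bigD1 j) //=; have [->|i0] := eqVneq i ord0.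
  rewrite aplu_cremona0 mul1r mulrAC mulfV // mul1r; apply: eq_bigl => k.
  by rewrite !inE orbb negb_or.
have dvi : dirvec x i != 0 by apply: Ux; rewrite ord_gt0.
rewrite [X in _ = _ * X * _](bigD1 i) /=; last by rewrite i0 eq_sym.
rewrite aplu_cremona ?ord_gt0 // invfM.
set P := \prod_(_ | _) _; set Q := \prod_(_ | _) _.
have -> : P = Q.
  by apply: eq_bigl => k; rewrite !inE !negb_or -andbA [X in _ && X]andbC andbA.
transitivity ((dirvec x j / dirvec x j) * (dirvec x i / dirvec x i) * (aplu x i j * Q)).
  by rewrite !mulfV // !mul1r.
by ring.
Qed.

Lemma cremona_formsP : exists2 F : pidx d -> {mpoly K[#|pidx d|]},
  forall X, represents X U C F &
  forall x i j, (i < j)%N -> aplu (feval F x) i j = cremona_form i j x.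
Proof.
have /choice[F FP] (a : pidx d) : exists f : {mpoly K[#|pidx d|]},
    f \is (d.-1).-homog /\ forall x, peval x f = cremona_form (val a).1 (val a).2 x.
  by have [f ? ?] := isform_cremona_form (valP a); exists f.
exists F => [X|x i j ij].
  split=> [|x Xx Ux a b]; first by exists d.-1 => a; have [] := FP a.
  rewrite [feval F x a]ffunE [feval F x b]ffunE (FP a).2 (FP b).2 !cremona_formE ?(valP a) ?(valP b) //.
  by rewrite -!aplu_val; ring.
by rewrite aplu_lt // /plu insubT //= ffunE (FP _).2 SubK.
Qed.

Lemma defined_at_form (X : set V) x i j : (i < j)%N ->
  cremona_form i j x != 0 -> defined_at X U C x.
Proof.
move=> ij fx; have [F repF FE] := cremona_formsP.
by exists F => //; apply: (aplu_neq0 (i := i) (j := j)); rewrite FE.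
Qed.

Lemma defined_one_zero (X : set V) x i : (0 < i)%N ->
  (forall j, (0 < j)%N -> j != i -> dirvec x j != 0) -> defined_at X U C x.
Proof.
move=> i0 dv; apply: (@defined_at_form X x ord0 i) => //.
rewrite /cremona_form eqxx mul1r; apply/prodf_neq0 => k.
by rewrite !inE orbb negb_or -ord_gt0 => /andP[k0 ki]; apply: dv.
Qed.

Lemma base_subspaces3 x i j k : x != 0 -> (0 < i)%N -> (0 < j)%N -> (0 < k)%N ->
  i != j -> i != k -> j != k ->
  dirvec x i = 0 -> dirvec x j = 0 -> dirvec x k = 0 -> base_subspaces x.
Proof.
move=> x0; wlog ij : i j / (i < j)%N.
  move=> W i0 j0 k0 ij ik jk xi xj xk.
  case: (ltngtP i j) => ij'; first exact: (W i j).
    by apply: (W j i) => //; rewrite eq_sym.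
  by rewrite (ord_inj ij') eqxx in ij.
move=> i0 j0 k0 _ ik jk xi xj xk; left.
case: (ltngtP j k) => jk'; first by exists i, j, k.
  case: (ltngtP i k) => ik'; first by exists i, k, j.
    by exists k, i, j.
  by rewrite (ord_inj ik') eqxx in ik.
by rewrite (ord_inj jk') eqxx in jk.
Qed.

Lemma base_subspaces2 x i j : x != 0 -> (0 < i)%N -> (0 < j)%N -> i != j ->
  dirvec x i = 0 -> dirvec x j = 0 -> aplu x i j = 0 -> base_subspaces x.
Proof.
move=> x0; wlog ij : i j / (i < j)%N.
  move=> W i0 j0 ij xi xj xij.
  case: (ltngtP i j) => ij'; first exact: (W i j).
    by apply: (W j i) => //; rewrite 1?eq_sym // apluC xij oppr0.
  by rewrite (ord_inj ij') eqxx in ij.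
move=> i0 j0 _ xi xj xij; right; exists i, j; split=> //.
by split=> //; split=> //; rewrite -aplu_lt.
Qed.

(** The number of vanishing direction coordinates decides. If p_0i is the only one or there is none,
    a form with indices 0 and i is nonzero. If p_0i and p_0j are the only ones, the form with
    indices i, j vanishes only when p_ij does, that is on L_ij. Three of them put the point on some
    L_ijk. *)
Lemma indeterminacy_sub_base (X : set V) : X `<=` @proj_space K (pidx d) ->
  indeterminacy X U C `<=` X `&` @base_subspaces K d.
Proof.
move=> X0 x [Xx ndef]; split=> //; apply: contrapT => nbase; apply: ndef.
have two i j : (0 < i)%N -> (i < j)%N -> dirvec x i = 0 -> dirvec x j = 0 ->
    defined_at X U C x.
  move=> i0 ij xi xj; have j0 := ltn_trans i0 ij.
  have ji : j != i by rewrite neq_ltn ij orbT.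
  apply: (@defined_at_form X x i j ij); rewrite /cremona_form -if_neg -ord_gt0 i0.
  apply: mulf_neq0.
    apply/eqP => xij; apply: nbase.
    by apply: (base_subspaces2 (X0 x Xx) i0 j0); rewrite // eq_sym.
  apply/prodf_neq0 => k; rewrite !inE !negb_or -ord_gt0 => /andP[/andP[k0 ki] kj].
  apply/eqP => xk; apply: nbase.
  by apply: (base_subspaces3 (X0 x Xx) i0 j0 k0); rewrite // eq_sym.
apply: contrapT => ndef.
have one i j : (0 < i)%N -> (0 < j)%N -> j != i -> dirvec x i = 0 ->
    dirvec x j != 0.
  move=> i0 j0 ji xi; apply/eqP => xj; apply: ndef; case: (ltngtP i j) => ij.
  - exact: two ij xi xj.
  - exact: two ij xj xi.
  - by rewrite (ord_inj ij) eqxx in ji.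
have [[i [i0 xi]]|nz] := pselect (exists i, (0 < i)%N /\ dirvec x i = 0).
  by apply: ndef; apply: (@defined_one_zero X x i) => // j j0 ji; apply: one xi.
apply: ndef; apply: (@defined_one_zero X x ord_max) => //=; first exact: ltnW.
by move=> j j0 _; apply/eqP => xj; apply: nz; exists j.
Qed.

Section Representations.
Variable X : set V.
Hypothesis iX : irreducible X.
Hypothesis X0 : X `<=` @proj_space K (pidx d).
Hypothesis XU : exists2 x, X x & U x.
Variable F : pidx d -> {mpoly K[#|pidx d|]}.
Hypothesis repF : represents X U C F.

Lemma isform_feval : exists e, forall i j, isform e (fun x => aplu (feval F x) i j).
Proof.
have [[e eF] _] := repF; exists e => i j.
have fplu k l : isform e (fun x => plu (feval F x) k l).
  rewrite /plu; case: insub => [a|] /=; last exact: isform0.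
  by exists (F a) => // x; rewrite ffunE.
rewrite /aplu; case: ltnP => _ //; case: ltnP => _; last exact: isform0.
by apply: isformN; apply: fplu.
Qed.

(** The torus is where the product of all direction coordinates is nonzero, so that product can be
    cancelled. *)
Lemma torus_dense e g : isform e g -> (forall x, X x -> U x -> g x = 0) ->
  forall x, X x -> g x = 0.
Proof.
move=> fg gU.
have fh : isform (\sum_(k : N | k != ord0) 1)
    (fun x : V => \prod_(k | k != ord0) dirvec x k).
  by apply: isform_prod => k _; apply: isform_dirvec.
apply: (irr_cancel iX X0 fg fh).
  have [x Xx Ux] := XU; exists x => //; apply/prodf_neq0 => k.
  by rewrite -ord_gt0; apply: Ux.
move=> x Xx /prodf_neq0 dv; apply: gU => // k; rewrite ord_gt0; exact: dv.
Qed.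

Lemma rep_aplu x i j k l : X x -> U x ->
  aplu (feval F x) i j * aplu (C x) k l = aplu (feval F x) k l * aplu (C x) i j.
Proof.
move=> Xx Ux; have [_ /(_ x Xx Ux) rel] := repF.
have aE (y : V) i' j' : (i' < j')%N -> exists a, forall y : V, plu y i' j' = y a.
  move=> ij; exists (Sub (i', j') ij) => z; by rewrite /plu insubT.
rewrite /aplu; case: (ltngtP i j) => [ij|ij|_]; last by rewrite mul0r mulr0.
  have [a aP] := aE x i j ij; rewrite !aP.
  case: (ltngtP k l) => [kl|kl|_]; last by rewrite mul0r mulr0.
    by have [b bP] := aE x k l kl; rewrite !bP.
  by have [b bP] := aE x l k kl; rewrite !bP mulrN rel mulNr.
have [a aP] := aE x j i ij; rewrite !aP.
case: (ltngtP k l) => [kl|kl|_]; last by rewrite mul0r mulr0.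
  by have [b bP] := aE x k l kl; rewrite !bP mulrN mulNr rel.
by have [b bP] := aE x l k kl; rewrite !bP mulrNN rel mulrNN.
Qed.

Lemma rep_dir x i j : X x -> (0 < i)%N -> (0 < j)%N ->
  aplu (feval F x) ord0 i * dirvec x i = aplu (feval F x) ord0 j * dirvec x j.
Proof.
move=> Xx i0 j0; have [e fF] := isform_feval.
apply/eqP; rewrite -subr_eq0; apply/eqP; move: x Xx.
apply: (torus_dense (e := e + 1)).
  by apply: isformB; apply: isformM (fF _ _) (isform_dirvec _ _).
move=> x Xx Ux; apply/eqP; rewrite subr_eq0; apply/eqP.
have := rep_aplu ord0 i ord0 j Xx Ux; rewrite !aplu_cremona0.
move=> /(congr1 (fun z => z * dirvec x i * dirvec x j)).
by rewrite mulrAC mulfVK ?Ux // => ->; rewrite mulfVK ?Ux.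
Qed.

Lemma rep_pair x i j : X x -> (0 < i)%N -> (0 < j)%N ->
  aplu (feval F x) i j * dirvec x j = aplu (feval F x) ord0 i * aplu x i j.
Proof.
move=> Xx i0 j0; have [e fF] := isform_feval.
apply/eqP; rewrite -subr_eq0; apply/eqP; move: x Xx.
apply: (torus_dense (e := e + 1)).
  apply: isformB; first exact: isformM (fF _ _) (isform_dirvec _ _).
  exact: isformM (fF _ _) (isform_aplu _ _ _).
move=> x Xx Ux; apply/eqP; rewrite subr_eq0; apply/eqP.
have := rep_aplu i j ord0 i Xx Ux; rewrite aplu_cremona0 aplu_cremona //.
move=> /(congr1 (fun z => z * dirvec x i * dirvec x j)).
rewrite mulfVK ?Ux // => ->; rewrite invfM.
transitivity (aplu (feval F x) ord0 i * aplu x i j *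
  (dirvec x i / dirvec x i) * (dirvec x j / dirvec x j)); first by ring.
by rewrite !mulfV ?Ux // !mulr1.
Qed.

Hypothesis iXi : forall i, (0 < i)%N ->
  irreducible (X `&` [set x | dirvec x i = 0]).
Hypothesis Xij : forall i j, (0 < i)%N -> (0 < j)%N -> i != j ->
  exists2 x, X x /\ dirvec x i = 0 & dirvec x j != 0.

Lemma rep_dir_zero x i j : X x -> (0 < i)%N -> (0 < j)%N -> i != j ->
  dirvec x i = 0 -> aplu (feval F x) ord0 j = 0.
Proof.
move=> Xx i0 j0 ij xi; have [e fF] := isform_feval.
have := @irr_cancel K _ _ _ _ _ _ (iXi i0) _ (fF ord0 j) (isform_dirvec K j) (Xij i0 j0 ij).
apply=> //; first by move=> y [/X0].
move=> y [Xy yi] yj; have := rep_dir Xy i0 j0.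
by rewrite [dirvec y i]yi mulr0 => /esym/eqP; rewrite mulf_eq0 (negPf yj) orbF => /eqP.
Qed.

(** On p_0m = 0 the coordinate F_0k is already known to vanish, so [rep_pair] reads F_kl p_0l = 0
    there, and p_0l can be cancelled. *)
Lemma rep_pair_zero x k l m : X x -> (0 < k)%N -> (0 < l)%N -> (0 < m)%N ->
  m != k -> m != l -> dirvec x m = 0 -> aplu (feval F x) k l = 0.
Proof.
move=> Xx k0 l0 m0 mk ml xm; have [e fF] := isform_feval.
have := @irr_cancel K _ _ _ _ _ _ (iXi m0) _ (fF k l) (isform_dirvec K l) (Xij m0 l0 ml).
apply=> //; first by move=> y [/X0].
move=> y [Xy ym] yl; have := rep_pair Xy k0 l0.
rewrite (rep_dir_zero Xy m0 k0 mk ym) mul0r => /eqP.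
by rewrite mulf_eq0 (negPf yl) orbF => /eqP.
Qed.

(** A pair of distinct positive indices other than i, j misses i or j, so one of the two vanishing
    direction coordinates kills its entry of F; only F_ij escapes this. *)
Lemma rep_two_zero x i j : X x -> (0 < i)%N -> (0 < j)%N -> i != j ->
  dirvec x i = 0 -> dirvec x j = 0 -> aplu (feval F x) i j = 0 ->
  feval F x = 0.
Proof.
move=> Xx i0 j0 ij xi xj Fij.
have F0 k : (0 < k)%N -> aplu (feval F x) ord0 k = 0.
  move=> k0; have [ik|ik] := eqVneq i k; last exact: rep_dir_zero ik xi.
  by apply: (rep_dir_zero Xx j0) => //; rewrite -ik eq_sym.
apply: aplu_eq0 => k l.
have [k0|k0] := posnP k.
  rewrite (ord_inj (k0 : k = ord0 :> nat)); have [l0|l0] := posnP l; last exact: F0.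
  by rewrite (ord_inj (l0 : l = ord0 :> nat)) apluii.
have [l0|l0] := posnP l.
  by rewrite (ord_inj (l0 : l = ord0 :> nat)) apluC F0 ?oppr0.
have [ik|ik] := eqVneq i k; have [jl|jl] := eqVneq j l.
- by rewrite -ik -jl.
- have [il|il] := eqVneq i l; first by rewrite -ik -il apluii.
  by apply: (rep_pair_zero Xx k0 l0 j0) => //; rewrite -ik eq_sym.
- have [jk|jk] := eqVneq j k; first by rewrite -jk -jl apluii.
  by apply: (rep_pair_zero Xx k0 l0 i0) => //; rewrite -jl.
have [il|il] := eqVneq i l; last exact: (rep_pair_zero Xx k0 l0 i0).
have [jk|jk] := eqVneq j k; first by rewrite -il -jk apluC Fij oppr0.
exact: (rep_pair_zero Xx k0 l0 j0).
Qed.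

End Representations.

(** By [rep_two_zero] only F_ij remains. On L_ijk the third vanishing coordinate kills it. On L_ij
    the section p_ij = 0 is used: [rep_pair] reads F_ij p_0j = 0 on it, and p_0j can be
    cancelled. *)
Lemma base_sub_indeterminacy (X : set V) : irreducible X ->
  X `<=` @proj_space K (pidx d) -> (exists2 x, X x & U x) ->
  (forall i, (0 < i)%N -> irreducible (X `&` [set x | dirvec x i = 0])) ->
  (forall i j, (0 < i)%N -> (0 < j)%N -> i != j ->
     exists2 x, X x /\ dirvec x i = 0 & dirvec x j != 0) ->
  (forall i j, (0 < i)%N -> (i < j)%N ->
     irreducible (X `&` [set x | plu x i j = 0])) ->
  (forall i j, (0 < i)%N -> (i < j)%N ->
     exists2 x, X x /\ plu x i j = 0 & dirvec x j != 0) ->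
  X `&` @base_subspaces K d `<=` indeterminacy X U C.
Proof.
move=> iX X0 XU iXi Xij iXp Xp x [Xx base]; split=> // -[F repF /negP[]].
apply/eqP; case: base => [[i [j [k [i0 ij jk [_ [xi xj xk]]]]]]|].
  have j0 := ltn_trans i0 ij; have k0 := ltn_trans j0 jk.
  have nij : i != j by rewrite neq_ltn ij.
  apply: (rep_two_zero iX X0 XU repF iXi Xij Xx i0 j0) => //.
  apply: (rep_pair_zero iX X0 XU repF iXi Xij Xx i0 j0 k0) => //.
    by rewrite neq_ltn (ltn_trans ij jk) orbT.
  by rewrite neq_ltn jk orbT.
move=> [i [j [i0 ij [_ [xij xi xj]]]]]; have j0 := ltn_trans i0 ij.
have nij : i != j by rewrite neq_ltn ij.
apply: (rep_two_zero iX X0 XU repF iXi Xij Xx i0 j0) => //.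
have [e fF] := isform_feval repF.
have := @irr_cancel K _ _ _ _ _ _ (iXp i j i0 ij) _ (fF i j) (isform_dirvec K j) (Xp i j i0 ij).
apply=> //; first by move=> y [/X0].
move=> y [Xy yij] yj; have := rep_pair iX X0 XU repF Xy i0 j0.
rewrite (aplu_lt y ij) [plu y i j]yij mulr0 => /eqP.
by rewrite mulf_eq0 (negPf yj) orbF => /eqP.
Qed.

End CremonaForms.

Lemma card_eq_finType (T : finType) : ([set: T] #= `I_#|T|)%card.
Proof.
pose f (t : T) : nat := enum_rank t.
have -> : `I_#|T| = [set f t | t in [set: T]].
  rewrite predeqE => n; split=> [nT|[t _ <-]]; last exact: (ltn_ord (enum_rank t)).
  by exists (enum_val (Ordinal (nT : (n < #|T|)%N))) => //; rewrite /f enum_valK.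
rewrite card_eq_sym; apply: inj_card_eq => s t _ _ /ord_inj; exact: enum_rank_inj.
Qed.

(** Counted by the larger index: [lift ord0 j], which is j + 1, has exactly j smaller positive
    indices, and [bin2_sum] adds these numbers. *)
Lemma card_pos_pairs d : #|[pred ij : 'I_d.+1 * 'I_d.+1 |
  (0 < ij.1)%N && (ij.1 < ij.2)%N]| = 'C(d, 2).
Proof.
rewrite -sum1_card -(pair_big_dep xpredT
  (fun i j : 'I_d.+1 => (0 < i)%N && (i < j)%N) (fun _ _ => 1%N)) /=.
rewrite (exchange_big_dep xpredT) //= -bin2_sum big_mkord big_ord_recl /=.
rewrite big1 ?add0n => [|i]; last by rewrite ltn0 andbF.
apply: eq_bigr => j _; have jd : (bump 0 j <= d.+1)%N := ltnW (ltn_ord (lift ord0 j)).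
rewrite -(big_ord_widen_cond _ (fun i => 0 < i)%N (fun=> 1%N) jd).
by rewrite big_mkcond big_ord_recl /= add0n sum1_card card_ord.
Qed.

Lemma irr_diff (K : fieldType) (I : finType) (A C : set {ffun I -> K}) :
  irreducible A -> zclosed C -> A `\` C !=set0 -> irreducible (A `\` C).
Proof.
move=> [_ iA] cC [a [Aa nCa]]; split; first by exists a.
move=> B B' cB cB' AB.
have AU : A `<=` (B `|` C) `|` (B' `|` C).
  move=> x Ax; have [Cx|nCx] := pselect (C x); first by left; right.
  by have [Bx|B'x] := AB x (conj Ax nCx); [left; left|right; left].
have [sub|sub] := iA _ _ (zclosedU cB cC) (zclosedU cB' cC) AU; [left|right].
  by move=> x [/sub[//|Cx] nCx].
by move=> x [/sub[//|Cx] nCx].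
Qed.

(** * The Cremona transformation exchanges G(1,d) and LG(d) *)

Section Theorem10.
Variables (K : fieldType) (d : nat).
Hypothesis K_inf : infinite_set [set: K].
Hypothesis d3 : (3 <= d)%N.
Local Notation V := {ffun pidx d -> K}.
Local Notation N := 'I_d.+1.
Local Notation U := (@torus K d).
Local Notation C := (@cremona K d).
Local Notation P := (@proj_space K (pidx d)).
Local Notation G := (@grassmannian K d).
Local Notation LGd := (@LG K d).
Local Notation inf := (@lines_at_infinity K d).
Implicit Types (p q x : V) (i j k l m : N).

Let d2 : (1 < d)%N := ltnW d3.

Lemma cardC_ord (A : {set N}) : #|~: A| = (d.+1 - #|A|)%N.
Proof. by rewrite cardsCs finset.setCK card_ord. Qed.

Lemma cards_ord2 i j : i != j -> #|[set i; j]%SET| = 2%N.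
Proof. by rewrite cards2 => ->. Qed.

Lemma cards_ord3 i j k : i != j -> i != k -> j != k ->
  #|[set i; j; k]%SET| = 3%N.
Proof.
move=> ij ik jk; rewrite finset.setUC cardsU1 cards_ord2 // !inE.
by rewrite !(eq_sym k) (negPf ik) (negPf jk).
Qed.

Lemma cards_ord4 i j k l : i != j -> i != k -> j != k -> i != l -> j != l ->
  k != l -> #|[set i; j; k; l]%SET| = 4%N.
Proof.
move=> ij ik jk il jl kl; rewrite finset.setUC cardsU1 cards_ord3 // !inE.
by rewrite !(eq_sym l) (negPf il) (negPf jl) (negPf kl).
Qed.

(** This is where [3 <= d] gives room: there are at least four indices, so a positive one remains
    beside any two. Points with prescribed zeros in their direction, and the Pluecker relation
    through 0, i, j and m, depend on it. *)
Lemma exists_other i j : exists k, [/\ (0 < k)%N, k != i & k != j].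
Proof.
have : (0 < #|~: [set ord0; i; j]%SET|)%N.
  rewrite cardC_ord subn_gt0 finset.setUC cardsU1 cards2.
  by apply: leq_ltn_trans (_ : 3 < d.+1)%N => //; case: (_ \notin _); case: (_ == _).
case/card_gt0P => k; rewrite !inE !negb_or -ord_gt0 => /andP[/andP[k0 ki] kj].
by exists k.
Qed.

(* Lines through the origin; these points also lie on LG(d). *)
Definition dirpt (f : N -> K) : V := wedge (fun l => (l == ord0)%:R) f.

Lemma dirvec_dirpt f l : (0 < l)%N -> dirvec (dirpt f) l = f l.
Proof.
rewrite ord_gt0 => /negPf l0.
by rewrite dirvecE aplu_wedge eqxx l0 mul1r mul0r subr0.
Qed.

Lemma aplu_dirpt f k l : (0 < k)%N -> (0 < l)%N -> aplu (dirpt f) k l = 0.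
Proof.
rewrite !ord_gt0 => /negPf k0 /negPf l0.
by rewrite aplu_wedge k0 l0 !mul0r subr0.
Qed.

Lemma dirpt_neq0 f l : (0 < l)%N -> f l != 0 -> dirpt f != 0.
Proof.
by move=> l0 fl; apply: (aplu_neq0 (i := ord0) (j := l)); rewrite -dirvecE dirvec_dirpt.
Qed.

Lemma dirpt_grassmannian f l : (0 < l)%N -> f l != 0 -> G (dirpt f).
Proof. by move=> l0 fl; apply: wedge_grassmannian; apply: dirpt_neq0 fl. Qed.

Lemma dirpt_LG f l : (0 < l)%N -> f l != 0 -> LGd (dirpt f).
Proof.
move=> l0 fl; apply/LGP; split; first exact: dirpt_neq0 fl.
by move=> i j k i0 j0 k0; rewrite !aplu_dirpt // subr0.
Qed.

Lemma torus_dirpt : U (dirpt (fun=> 1)).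
Proof. by move=> l l0; rewrite dirvec_dirpt // oner_eq0. Qed.

Let maxpos : (0 < (ord_max : N))%N.
Proof. exact: ltnW (ltnW d3). Qed.

Lemma torus_meets (X : set V) : G `<=` X \/ LGd `<=` X -> exists2 x, X x & U x.
Proof.
have n1 : (1 : K) != 0 by apply: oner_neq0.
case=> sub; exists (dirpt (fun=> 1)); try exact: torus_dirpt; apply: sub.
  exact: (@dirpt_grassmannian _ ord_max).
exact: (@dirpt_LG _ ord_max).
Qed.

Lemma G_sub_P : G `<=` P. Proof. by move=> p []. Qed.
Lemma LG_sub_P : LGd `<=` P. Proof. by move=> p []. Qed.

Lemma torus_closed : exists2 B : set V, zclosed B & forall x, x != 0 -> U x <-> ~ B x.
Proof.
have fh : isform (\sum_(k : N | k != ord0) 1)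
    (fun x : V => \prod_(k | k != ord0) dirvec x k).
  by apply: isform_prod => k _; apply: isform_dirvec.
exists [set x : V | x != 0 /\ \prod_(k | k != ord0) dirvec x k = 0].
  exact: zclosed_zeros fh.
move=> x x0; split=> [Ux [_ /eqP]|nB k k0].
  by apply/negP/prodf_neq0 => k; rewrite -ord_gt0; apply: Ux.
apply/eqP => xk; apply: nB; split=> //.
by apply/eqP; apply/prodf_eq0; exists k; rewrite -?ord_gt0 ?xk.
Qed.

Lemma cremona_rational (X Y : set V) : variety X -> variety Y ->
  (exists2 x, X x & U x) -> (forall x, X x -> U x -> Y (C x)) ->
  rational_map X Y U C.
Proof.
move=> vX vY [x0 Xx0 Ux0] XY; split=> //.
- by exists x0.
- have [B cB UB] := torus_closed; exists B => //.
  have X0 := zclosed_sub_proj vX.1.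
  by rewrite predeqE => x; split=> -[Xx Ux]; split=> //; apply/(UB x (X0 x Xx)).
- move=> x Xx Ux; apply: (@defined_one_zero K d X x ord_max) => // j j0 _.
  exact: Ux.
Qed.

Lemma cremona_birational (X Y : set V) : variety X -> variety Y ->
  (exists2 x, X x & U x) ->
  (forall x, X x -> U x -> Y (C x)) -> (forall x, Y x -> U x -> X (C x)) ->
  birational_map X Y U C.
Proof.
move=> vX vY [x0 Xx0 Ux0] XY YX.
have same x : U x -> same_point x (C (C x)).
  move=> /cremonaK[_ ->]; exists 1; first exact: oner_neq0.
  by apply/ffunP => a; rewrite ffunE mul1r.
split; first by apply: cremona_rational => //; exists x0.
have UC x : U x -> U (C x) by move=> /cremonaK[].
exists U, C; split.
- by apply: cremona_rational => //; exists (C x0); [apply: XY|apply: UC].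
- by exists x0; split=> //; apply: UC.
- by exists (C x0); split; [apply: XY|apply: UC|apply/UC/UC].
- by move=> x Xx Ux _; apply: same.
- by move=> x Yx Ux _; apply: same.
Qed.

(** Dividing the Pluecker relation with indices 0, i, j, k by p_0i p_0j p_0k turns it into the
    linear relation of LG(d). *)
Lemma cremona_G_LG p : G p -> U p -> LGd (C p).
Proof.
move=> /grassmannianP[p0 pG] Up; have [UC _] := cremonaK Up.
apply/LGP; split=> [|i j k i0 j0 k0].
  have := UC _ maxpos; rewrite dirvecE; exact: aplu_neq0.
rewrite !aplu_cremona //.
have := pG ord0 i j k; rewrite /plucker -!dirvecE => /eqP.
have di := Up _ i0; have dj := Up _ j0; have dk := Up _ k0.
move=> /eqP E; apply/eqP; rewrite -subr_eq0; apply/eqP.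
transitivity ((dirvec p i * aplu p j k - dirvec p j * aplu p i k +
  dirvec p k * aplu p i j) / (dirvec p i * dirvec p j * dirvec p k)).
  by field; rewrite di dj dk.
by rewrite E mul0r.
Qed.

(** The relations with index 0 are those of LG(d) divided by the direction coordinates. In the
    others all denominators agree, and the numerators are differences of the numbers q_il, for which
    the quadratic relation is an identity. *)
Lemma cremona_LG_G q : LGd q -> U q -> G (C q).
Proof.
move=> /LGP[q0 qL] Uq; have [UC _] := cremonaK Uq.
split=> [|i j k l ij jk kl].
  have := UC _ maxpos; rewrite dirvecE; exact: aplu_neq0.
have j0 : (0 < j)%N by apply: leq_ltn_trans ij.
have k0 := ltn_trans j0 jk; have l0 := ltn_trans k0 kl.
have dj := Uq _ j0; have dk := Uq _ k0; have dl := Uq _ l0.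
have ik := ltn_trans ij jk; have jl := ltn_trans jk kl.
have il := ltn_trans ij jl.
rewrite -!aplu_lt //.
have [i0|i0] := posnP i.
  rewrite (ord_inj (i0 : i = ord0 :> nat)) !aplu_cremona0 !aplu_cremona //.
  by rewrite (qL j k l) //; field; rewrite dj dk dl.
have di := Uq _ i0.
rewrite !aplu_cremona // (qL i k l) // (qL i j l) // (qL i j k) //.
by field; rewrite di dj dk dl.
Qed.

End Theorem10.

(** * Indeterminacy on Pluecker space and on LG(d) *)

Section ProjectiveAndLinear.
Variables (K : fieldType) (d : nat).
Hypothesis K_inf : infinite_set [set: K].
Hypothesis d3 : (3 <= d)%N.
Local Notation V := {ffun pidx d -> K}.
Local Notation N := 'I_d.+1.
Local Notation U := (@torus K d).
Local Notation C := (@cremona K d).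
Local Notation P := (@proj_space K (pidx d)).
Local Notation G := (@grassmannian K d).
Local Notation LGd := (@LG K d).
Local Notation CS := (@coord_subspace K (pidx d)).
Implicit Types (p q x : V) (i j k l m : N).

Let d2 : (1 < d)%N := ltnW d3.

Definition pij i j (ij : (i < j)%N) : pidx d := Sub (i, j) ij.

Lemma plu_pij (x : V) i j (ij : (i < j)%N) : plu x i j = x (pij ij).
Proof. by rewrite /plu insubT. Qed.

Lemma dirvec_pij (x : V) i (i0 : (0 < i)%N) :
  dirvec x i = x (pij (i0 : ((ord0 : N) < i)%N)).
Proof. exact: plu_pij. Qed.

Lemma pij_eq i j k l (ij : (i < j)%N) (kl : (k < l)%N) :
  (pij ij == pij kl) = (i == k) && (j == l).
Proof. by rewrite -val_eqE /= xpair_eqE. Qed.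

Lemma projE : P = CS finset.set0.
Proof.
by rewrite predeqE => x; split=> [x0|[]//]; split=> // a; rewrite inE.
Qed.

Lemma coord_subspace1 (a : pidx d) :
  P `&` [set x : V | x a = 0] = CS [set a]%SET.
Proof.
rewrite predeqE => x; split=> [[x0 xa]|[x0 xS]]; split=> //.
  by move=> b; rewrite inE => /eqP->.
by apply: xS; rewrite inE.
Qed.

Lemma coord_subspace_irr (S : {set pidx d}) :
  (0 < #|~: S|)%N -> irreducible (CS S).
Proof. by move=> S0; have [[_]] := coord_subspace_variety_dim K_inf S0. Qed.

Lemma proj_variety_dim : variety P /\ has_dim P #|pidx d|.-1.
Proof.
rewrite projE; have := @coord_subspace_variety_dim K (pidx d) K_inf finset.set0.
rewrite finset.setC0 cardsT; apply.
have [k [k0 _ _]] := exists_other d3 ord0 ord0.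
by apply/card_gt0P; exists (pij (k0 : ((ord0 : N) < k)%N)).
Qed.

(** The fourth coordinate [e] shows that three equations leave a nonempty subspace, of projective
    dimension [#|pidx d| - 3 - 1]. The bound [4 <= #|pidx d|] is kept so that the truncated
    subtraction can later be undone in the codimension. *)
Lemma coord3_dim (a b c e : pidx d) : a != b -> a != c -> b != c ->
  e != a -> e != b -> e != c ->
  zclosed (CS [set a; b; c]%SET) /\
  has_dim (CS [set a; b; c]%SET) (#|pidx d| - 4) /\
  (4 <= #|pidx d|)%N.
Proof.
move=> ab ac bc ea eb ec.
have S3 : #|[set a; b; c]%SET| = 3%N.
  rewrite finset.setUC cardsU1 cards2 ab !inE.
  by rewrite !(eq_sym c) (negPf ac) (negPf bc).
have SC0 : (0 < #|~: [set a; b; c]%SET|)%N.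
  by apply/card_gt0P; exists e; rewrite !inE !negb_or ea eb ec.
have [[cS _] dS] := coord_subspace_variety_dim K_inf SC0.
have cS3 : #|~: [set a; b; c]%SET| = (#|pidx d| - 3)%N.
  by rewrite cardsCs finset.setCK S3.
rewrite cS3 in dS SC0; split=> //; rewrite subnS; split=> //.
by rewrite -subn_gt0.
Qed.

Lemma L3E i j k (i0 : (0 < i)%N) (j0 : (0 < j)%N) (k0 : (0 < k)%N) :
  L3 i j k = CS [set pij (i0 : ((ord0 : N) < i)%N);
    pij (j0 : ((ord0 : N) < j)%N); pij (k0 : ((ord0 : N) < k)%N)]%SET.
Proof.
rewrite predeqE => x; split=> [[x0 [xi xj xk]]|[x0 xS]]; split=> //.
  move=> a; rewrite !inE -orbA.
  by case/or3P => /eqP->; rewrite -dirvec_pij.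
by split; rewrite dirvec_pij xS // !inE eqxx ?orbT.
Qed.

Lemma L2E i j (ij : (i < j)%N) (i0 : (0 < i)%N) (j0 : (0 < j)%N) :
  L2 i j = CS [set pij ij; pij (i0 : ((ord0 : N) < i)%N);
    pij (j0 : ((ord0 : N) < j)%N)]%SET.
Proof.
rewrite predeqE => x; split=> [[x0 [xij xi xj]]|[x0 xS]]; split=> //.
  move=> a; rewrite !inE -orbA.
  by case/or3P => /eqP->; rewrite -?dirvec_pij -?plu_pij.
by split; rewrite ?dirvec_pij ?(plu_pij x ij) xS // !inE eqxx ?orbT.
Qed.

Lemma ord0_neq i : (0 < i)%N -> ((ord0 : N) == i) = false.
Proof. by move=> i0; rewrite eq_sym; apply/negbTE; rewrite -ord_gt0. Qed.

Lemma neq0_ord i : (0 < i)%N -> (i == ord0 :> N) = false.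
Proof. by move=> i0; rewrite eq_sym ord0_neq. Qed.

Lemma L3_dim i j k : (0 < i)%N -> (i < j)%N -> (j < k)%N ->
  zclosed (@L3 K d i j k) /\ has_dim (@L3 K d i j k) (#|pidx d| - 4).
Proof.
move=> i0 ij jk; have j0 := ltn_trans i0 ij; have k0 := ltn_trans j0 jk.
rewrite (L3E i0 j0 k0).
have ik := ltn_trans ij jk.
have [||||||cS [dS _]] := @coord3_dim (pij (i0 : ((ord0 : N) < i)%N))
  (pij (j0 : ((ord0 : N) < j)%N)) (pij (k0 : ((ord0 : N) < k)%N)) (pij ij) => //;
  rewrite pij_eq ?eqxx ?neq0_ord //= neq_ltn ?ij ?jk ?ik //.
Qed.

Lemma L2_dim i j : (0 < i)%N -> (i < j)%N ->
  [/\ zclosed (@L2 K d i j), has_dim (@L2 K d i j) (#|pidx d| - 4) &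
   (4 <= #|pidx d|)%N].
Proof.
move=> i0 ij; have j0 := ltn_trans i0 ij.
have [k [k0 ki kj]] := exists_other d3 i j.
rewrite (L2E ij i0 j0).
have [||||||cS [dS ?]] := @coord3_dim (pij ij) (pij (i0 : ((ord0 : N) < i)%N))
  (pij (j0 : ((ord0 : N) < j)%N)) (pij (k0 : ((ord0 : N) < k)%N)) => //;
  rewrite pij_eq ?eqxx ?neq0_ord ?ord0_neq //= ?(negPf ki) ?(negPf kj) //.
by rewrite neq_ltn ij.
Qed.

Definition base_index : finType := (N * N * N + N * N)%type.

Definition base_cond (t : base_index) : bool :=
  match t with
  | inl (i, j, k) => [&& 0 < i, i < j & j < k]%N
  | inr (i, j) => (0 < i)%N && (i < j)%N
  end.

Definition base_member (t : base_index) : set V :=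
  match t with inl (i, j, k) => L3 i j k | inr (i, j) => L2 i j end.

Lemma base_coverP x : base_subspaces x <->
  exists2 t, base_cond t & base_member t x.
Proof.
split=> [[[i [j [k [i0 ij jk xL]]]]|[i [j [i0 ij xL]]]]|].
- by exists (inl (i, j, k)) => //=; rewrite i0 ij jk.
- by exists (inr (i, j)) => //=; rewrite i0 ij.
case=> -[[[i j] k] /= /and3P[i0 ij jk]|[i j] /= /andP[i0 ij]] xL.
  by left; exists i, j, k.
by right; exists i, j.
Qed.

Lemma base_member_closed t : base_cond t -> zclosed (base_member t).
Proof.
case: t => [[[i j] k]|[i j]] /=; last by move=> /andP[i0 ij]; have [] := L2_dim i0 ij.
by move=> /and3P[i0 ij jk]; have [] := L3_dim i0 ij jk.
Qed.

Lemma first_pair : exists i j : N, (0 < i)%N /\ (i < j)%N.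
Proof.
by exists (inord 1), (inord 2); rewrite !inordK // ltnS ltnW.
Qed.

Lemma base_has_dim : has_dim (@base_subspaces K d) (#|pidx d| - 4) /\
  (4 <= #|pidx d|)%N.
Proof.
have [i [j [i0 ij]]] := first_pair; have [_ [chain _] le4] := L2_dim i0 ij.
split=> //; apply: (has_dim_cover (P := base_cond) base_member_closed).
- by move=> x /base_coverP[t ct xt]; exists t.
- case=> [[[i' j'] k] m /= /and3P[i0' ij' jk]|[i' j'] m /= /andP[i0' ij']].
    by have [_ [_ +]] := L3_dim i0' ij' jk; apply.
  by have [_ [_ +] _] := L2_dim i0' ij'; apply.
by apply: variety_chainS chain => x xL; right; exists i, j.
Qed.

Lemma indeterminacy_proj : indeterminacy P U C = @base_subspaces K d.
Proof.
have PP : P `<=` P by [].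
have baseP : @base_subspaces K d `<=` P.
  by move=> x [[i [j [k [_ _ _ []]]]]|[i [j [_ _ []]]]].
have card1 (a : pidx d) : irreducible (P `&` [set x : V | x a = 0]).
  rewrite coord_subspace1; apply: coord_subspace_irr; apply/card_gt0P.
  have [i [j [i0 ij]]] := first_pair; have j0 := ltn_trans i0 ij.
  have [<-|] := eqVneq (pij ij) a; last by exists (pij ij); rewrite !inE.
  by exists (pij (j0 : ((ord0 : N) < j)%N)); rewrite !inE pij_eq ord0_neq.
rewrite eqEsubset; split.
  by apply: subset_trans (@indeterminacy_sub_base K d d2 P PP) _ => x [].
apply: subset_trans (_ : P `&` @base_subspaces K d `<=` _).
  by move=> x bx; split=> //; apply: baseP.
have [[_ iP] _] := proj_variety_dim.
apply: base_sub_indeterminacy => //.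
- by apply: (torus_meets d3); left; apply: G_sub_P.
- move=> i i0; have := card1 (pij (i0 : ((ord0 : N) < i)%N)).
  by congr irreducible; rewrite predeqE => x; split=> -[xP xi]; split=> //;
    rewrite /= ?dirvec_pij // -dirvec_pij.
- move=> i j i0 j0 ij; exists (dirpt (fun l => (l == j)%:R)).
    split; last by rewrite dirvec_dirpt // (negPf ij).
    by apply: (dirpt_neq0 j0); rewrite eqxx oner_eq0.
  by rewrite dirvec_dirpt // eqxx oner_eq0.
- move=> i j i0 ij; have := card1 (pij ij).
  by congr irreducible; rewrite predeqE => x; split=> -[xP xi]; split=> //;
    rewrite /= ?plu_pij // -plu_pij.
move=> i j i0 ij; have j0 := ltn_trans i0 ij.
exists (dirpt (fun l => (l == j)%:R)).
  split; last by rewrite -aplu_lt // aplu_dirpt.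
  by apply: (dirpt_neq0 j0); rewrite eqxx oner_eq0.
by rewrite dirvec_dirpt // eqxx oner_eq0.
Qed.

Lemma indeterminacy_proj_codim : has_codim P (indeterminacy P U C) 3.
Proof.
split=> [x []//|]; rewrite indeterminacy_proj.
have [dim le4] := base_has_dim; exists (#|pidx d| - 4)%N; split=> //.
have [_] := proj_variety_dim; rewrite -subn1.
by rewrite addnBAC // -[4%N]/(1 + 3)%N subnDr.
Qed.

End ProjectiveAndLinear.

(** * LG(d) and its coordinate sections *)

Section LinearSpace.
Variables (K : fieldType) (d : nat).
Hypothesis K_inf : infinite_set [set: K].
Hypothesis d3 : (3 <= d)%N.
Local Notation V := {ffun pidx d -> K}.
Local Notation N := 'I_d.+1.
Local Notation U := (@torus K d).
Local Notation C := (@cremona K d).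
Local Notation P := (@proj_space K (pidx d)).
Local Notation G := (@grassmannian K d).
Local Notation LGd := (@LG K d).
Local Notation LGS := (@LGsub K d).
Implicit Types (p q x : V) (i j k l m : N).

Let d2 : (1 < d)%N := ltnW d3.

(** The base index [m] is free, and it is left out of the second set because u_m = q_mm = 0. This
    leaves d coordinates q_0l and d - 1 differences u_l, whence the dimension 2d - 2. *)
Lemma LGE m : (0 < m)%N -> LGd = LGS (~: [set ord0])%SET (~: [set ord0; m])%SET m.
Proof.
move=> m0; rewrite predeqE => q; split=> [Lq|[]//]; split=> // l l0.
  by rewrite !inE negbK -[l == _]negbK -ord_gt0 l0.
rewrite !inE negbK => /orP[|/eqP->]; last exact: apluii.
by rewrite -[l == _]negbK -ord_gt0 l0.
Qed.

Lemma LG_dir0E m i : (0 < m)%N -> LGd `&` [set q | dirvec q i = 0] =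
  LGS (~: [set ord0; i])%SET (~: [set ord0; m])%SET m.
Proof.
move=> m0; rewrite predeqE => q; split=> [[Lq qi]|[Lq qS _]]; split=> //.
- move=> l l0; rewrite !inE negbK neq0_ord //= => /eqP->.
  by rewrite -dirvecE.
- move=> l l0; rewrite !inE negbK neq0_ord //= => /eqP->.
  exact: apluii.
have [i0|i0] := posnP i; last by rewrite /= dirvecE qS // !inE eqxx orbT.
by rewrite (ord_inj (i0 : i = ord0 :> nat)) /= dirvecE apluii.
Qed.

(** With base index i the coordinate q_ij is the parameter u_j, so the hyperplane section becomes a
    coordinate subspace. *)
Lemma LG_plu0E i j : (0 < i)%N -> (i < j)%N -> LGd `&` [set q | plu q i j = 0] =
  LGS (~: [set ord0])%SET (~: [set ord0; i; j])%SET i.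
Proof.
move=> i0 ij; rewrite predeqE => q; split=> [[Lq qij]|[Lq _ qT]]; split=> //.
- by move=> l l0; rewrite !inE negbK neq0_ord.
- move=> l l0; rewrite !inE negbK neq0_ord //= => /orP[]/eqP->.
    exact: apluii.
  by rewrite aplu_lt.
have j0 := ltn_trans i0 ij.
by rewrite /= -aplu_lt // qT // !inE eqxx orbT.
Qed.

Lemma LG_L3E i j k : (0 < i)%N -> (0 < j)%N -> (0 < k)%N ->
  LGd `&` L3 i j k = LGS (~: [set ord0; i; j; k])%SET (~: [set ord0; i])%SET i.
Proof.
move=> i0 j0 k0; rewrite predeqE => q; split=> [[Lq [_ [qi qj qk]]]|[Lq qS _]].
  split=> // l l0; rewrite !inE negbK neq0_ord //=; last by move=> /eqP->; exact: apluii.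
  by rewrite -orbA; case/or3P => /eqP->; rewrite -dirvecE.
split=> //; split; first by case: Lq.
by split; rewrite dirvecE qS // !inE eqxx ?orbT.
Qed.

Lemma LG_L2E i j : (0 < i)%N -> (i < j)%N ->
  LGd `&` L2 i j = LGS (~: [set ord0; i; j])%SET (~: [set ord0; i; j])%SET i.
Proof.
move=> i0 ij; have j0 := ltn_trans i0 ij.
rewrite predeqE => q; split=> [[Lq [_ [qij qi qj]]]|[Lq qS qT]].
  split=> // l l0; rewrite !inE negbK neq0_ord //= => /orP[]/eqP->.
  - by rewrite -dirvecE.
  - by rewrite -dirvecE.
  - exact: apluii.
  - by rewrite aplu_lt.
split=> //; split; first by case: Lq.
split; last 2 first.
- by rewrite dirvecE qS // !inE eqxx ?orbT.
- by rewrite dirvecE qS // !inE eqxx ?orbT.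
by rewrite -aplu_lt // qT // !inE eqxx orbT.
Qed.

Lemma LG_variety_dim : variety LGd /\ has_dim LGd (2 * d - 2).
Proof.
have [m [m0 _ _]] := exists_other d3 ord0 ord0.
rewrite (LGE m0).
have := @LGsub_variety_dim K d K_inf (~: [set ord0])%SET (~: [set ord0; m])%SET m.
rewrite !inE !eqxx ?orbT => /(_ isT isT isT m0).
rewrite !cardC_ord cards1 cards_ord2 ?ord0_neq //.
have -> : (d.+1 - 1 + (d.+1 - 2)).-1 = (2 * d - 2)%N.
  by lia.
by apply; rewrite subSS subn0 addn_gt0 (ltnW (ltnW d3)).
Qed.

Lemma LG_L3_dim i j k : (0 < i)%N -> (i < j)%N -> (j < k)%N ->
  has_dim (LGd `&` @L3 K d i j k) (2 * d - 5).
Proof.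
move=> i0 ij jk; have j0 := ltn_trans i0 ij; have k0 := ltn_trans j0 jk.
rewrite (LG_L3E i0 j0 k0).
have := @LGsub_variety_dim K d K_inf (~: [set ord0; i; j; k])%SET
  (~: [set ord0; i])%SET i.
rewrite !inE !eqxx ?orbT => /(_ isT isT isT i0).
have nij : i != j by rewrite neq_ltn ij.
have njk : j != k by rewrite neq_ltn jk.
have nik : i != k by rewrite neq_ltn (ltn_trans ij jk).
rewrite !cardC_ord cards_ord4 ?cards_ord2 ?ord0_neq //.
have -> : (d.+1 - 4 + (d.+1 - 2)).-1 = (2 * d - 5)%N.
  by lia.
by case=> //; lia.
Qed.

Lemma LG_L2_dim i j : (0 < i)%N -> (i < j)%N ->
  has_dim (LGd `&` @L2 K d i j) (2 * d - 5).
Proof.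
move=> i0 ij; have j0 := ltn_trans i0 ij.
rewrite (LG_L2E i0 ij).
have := @LGsub_variety_dim K d K_inf (~: [set ord0; i; j])%SET
  (~: [set ord0; i; j])%SET i.
rewrite !inE !eqxx ?orbT => /(_ isT isT isT i0).
have nij : i != j by rewrite neq_ltn ij.
rewrite !cardC_ord cards_ord3 ?ord0_neq //.
have -> : (d.+1 - 3 + (d.+1 - 3)).-1 = (2 * d - 5)%N.
  by lia.
by case=> //; lia.
Qed.

(** Both kinds of subspace cost three parameters on LG(d): L_ijk removes three of the q_0l, while
    L_ij removes two of them and one difference. *)
Lemma LG_base_has_dim : has_dim (LGd `&` @base_subspaces K d) (2 * d - 5).
Proof.
have [cL _] := LG_variety_dim.1.
have [i [j [i0 ij]]] := @first_pair d d3.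
apply: (has_dim_cover (P := @base_cond d) (B := fun t => LGd `&` base_member t)).
- by move=> t ct; apply: zclosedI => //; apply: base_member_closed.
- by move=> x [Lx /base_coverP[t ct xt]]; exists t.
- case=> [[[i' j'] k] m /= /and3P[i0' ij' jk]|[i' j'] m /= /andP[i0' ij']].
    by have [_ +] := LG_L3_dim i0' ij' jk; apply.
  by have [_ +] := LG_L2_dim i0' ij'; apply.
have [chain _] := LG_L2_dim i0 ij.
by apply: variety_chainS chain => x [Lx xL]; split=> //; right; exists i, j.
Qed.

Lemma indeterminacy_LG : indeterminacy LGd U C = LGd `&` @base_subspaces K d.
Proof.
have LP := @LG_sub_P K d.
rewrite eqEsubset; split; first exact: indeterminacy_sub_base.
have [[_ iL] _] := LG_variety_dim.
have subirr (S T : {set N}) m : ord0 \notin S -> ord0 \notin T -> m \notin T -> (0 < m)%N ->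
    (0 < #|S| + #|T|)%N -> irreducible (LGS S T m).
  by move=> S0 T0 mT m0 ST; have [[_]] := LGsub_variety_dim K_inf S0 T0 mT m0 ST.
apply: base_sub_indeterminacy => //.
- by apply: (torus_meets d3); right.
- move=> i i0; rewrite (LG_dir0E i i0); apply: subirr; rewrite ?inE ?eqxx ?orbT //.
  by rewrite !cardC_ord cards_ord2 ?ord0_neq //; lia.
- move=> i j i0 j0 ij; exists (dirpt (fun l => (l == j)%:R)).
    split; last by rewrite dirvec_dirpt // (negPf ij).
    by apply: (dirpt_LG j0); rewrite eqxx oner_eq0.
  by rewrite dirvec_dirpt // eqxx oner_eq0.
- move=> i j i0 ij; rewrite (LG_plu0E i0 ij); apply: subirr; rewrite ?inE ?eqxx ?orbT //.
  by rewrite !cardC_ord cards1; lia.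
move=> i j i0 ij; have j0 := ltn_trans i0 ij.
exists (dirpt (fun l => (l == j)%:R)).
  split; last by rewrite -aplu_lt // aplu_dirpt.
  by apply: (dirpt_LG j0); rewrite eqxx oner_eq0.
by rewrite dirvec_dirpt // eqxx oner_eq0.
Qed.

Lemma indeterminacy_LG_codim : has_codim LGd (indeterminacy LGd U C) 3.
Proof.
split=> [x []//|]; rewrite indeterminacy_LG; exists (2 * d - 5)%N.
split; first exact: LG_base_has_dim.
have [_] := LG_variety_dim; congr has_dim.
by lia.
Qed.

End LinearSpace.

(** * Indeterminacy on the Grassmannian *)

Section Grassmannian.
Variables (K : fieldType) (d : nat).
Hypothesis K_inf : infinite_set [set: K].
Hypothesis d3 : (3 <= d)%N.
Local Notation V := {ffun pidx d -> K}.
Local Notation N := 'I_d.+1.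
Local Notation U := (@torus K d).
Local Notation C := (@cremona K d).
Local Notation G := (@grassmannian K d).
Local Notation inf := (@lines_at_infinity K d).
Local Notation WS := (@Wset K d).
Implicit Types (p q x : V) (i j k l m : N).

Let d2 : (1 < d)%N := ltnW d3.

Lemma exists_aplu p : p != 0 -> exists a b, aplu p a b != 0.
Proof.
by move=> /exists_coord[a]; rewrite aplu_val; exists (val a).1, (val a).2.
Qed.

Lemma G_closed : zclosed G.
Proof.
have fpl (t : N * N * N * N) :
    isform 2 (fun p : V => plucker p t.1.1.1 t.1.1.2 t.1.2 t.2).
  have fa i j := @isform_aplu K d i j.
  rewrite /plucker; apply: isformD; last exact: isformM (fa _ _) (fa _ _).
  by apply: isformB; apply: isformM (fa _ _) (fa _ _).
have := zclosed_forms fpl; congr zclosed; rewrite predeqE => p.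
split=> [[p0 pG]|/grassmannianP[p0 pG]]; last by split.
by apply/grassmannianP; split=> // i j k l; apply: (pG (i, j, k, l)).
Qed.

Lemma G_dir_closed i : zclosed (G `&` [set p | dirvec p i = 0]).
Proof.
have := zclosedI G_closed (zclosed_zeros (@isform_dirvec K d i)).
congr zclosed; rewrite predeqE => p.
by split=> [[Gp [_ pi]]|[Gp pi]]; do 2?split=> //; case: Gp.
Qed.

Lemma inf_closed : zclosed inf.
Proof.
have := zclosedI G_closed
  (zclosed_forms (fun i : {i : N | (0 < i)%N} => @isform_dirvec K d (val i))).
congr zclosed; rewrite predeqE => p.
split=> [[Gp [_ pi]]|[Gp pi]]; split=> //.
  by move=> i i0; apply: (pi (exist _ i i0)).
by split=> [|[i i0] /=]; [case: Gp | apply: pi].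
Qed.

Lemma WsetI (S T : {set N}) p a b : G p -> aplu p a b != 0 ->
  (forall l, l \notin S -> aplu p b l = 0) ->
  (forall l, l \notin T -> aplu p a l = 0) -> WS S T p.
Proof.
move=> Gp pab pS pT; split; first by case: Gp.
exists (fun l => - aplu p b l / aplu p a b), (fun l => aplu p a l); split=> //.
  by move=> l /pS ->; rewrite oppr0 mul0r.
exact: wedge_decomp.
Qed.

Lemma GE : G = WS finset.setT finset.setT.
Proof.
rewrite eqEsubset; split; last exact: Wset_grassmannian.
move=> p Gp; have [a [b pab]] := exists_aplu (G_sub_P Gp).
by apply: (WsetI Gp pab) => l; rewrite inE.
Qed.

(** The condition p_0i = 0 says that the line meets the subspace z_0 = z_i = 0. A spanning point
    there is row 0 of [p] if that row is nonzero, otherwise row i if nonzero, otherwise any nonzero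
    row. Thus lines at infinity are covered by the same parametrization. *)
Lemma G_dir0E i : (0 < i)%N ->
  G `&` [set p | dirvec p i = 0] = WS finset.setT (~: [set ord0; i])%SET.
Proof.
move=> i0; rewrite predeqE => p; split=> [[Gp pi]|Wp].
  have S0 b l : l \notin [set: N]%SET -> aplu p b l = 0 by rewrite inE.
  have [[b pb]|n0] := pselect (exists b, aplu p ord0 b != 0).
    apply: (WsetI Gp pb) => [|l]; first exact: S0.
    rewrite !inE negbK => /orP[]/eqP->; first exact: apluii.
    by rewrite -dirvecE.
  have z0 b : aplu p ord0 b = 0.
    by apply: contrapT => /eqP pb; apply: n0; exists b.
  have [[b pb]|ni] := pselect (exists b, aplu p i b != 0).
    apply: (WsetI Gp pb) => [|l]; first exact: S0.
    rewrite !inE negbK => /orP[]/eqP->; last exact: apluii.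
    by rewrite apluC z0 oppr0.
  have zi b : aplu p i b = 0.
    by apply: contrapT => /eqP pb; apply: ni; exists b.
  have [a [b pab]] := exists_aplu (G_sub_P Gp).
  apply: (WsetI Gp pab) => [|l]; first exact: S0.
  by rewrite !inE negbK => /orP[]/eqP->; rewrite apluC ?z0 ?zi oppr0.
split; first exact: Wset_grassmannian Wp.
have [_ [x [v [_ vT ->]]]] := Wp.
by rewrite /= dirvecE aplu_wedge !vT ?inE ?eqxx ?orbT // !mulr0 subr0.
Qed.

Lemma infE : inf = WS (~: [set ord0])%SET (~: [set ord0])%SET.
Proof.
rewrite predeqE => p; split=> [[Gp pi]|Wp].
  have [a [b pab]] := exists_aplu (G_sub_P Gp).
  have p0 l : aplu p l ord0 = 0.
    rewrite apluC -dirvecE; have [l0|l0] := posnP l; last by rewrite pi ?oppr0.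
    by rewrite (ord_inj (l0 : l = ord0 :> nat)) dirvecE apluii oppr0.
  by apply: (WsetI Gp pab) => l; rewrite !inE negbK => /eqP->.
split=> [|i i0]; first exact: Wset_grassmannian Wp.
have [_ [x [v [xS vT ->]]]] := Wp.
by rewrite dirvecE aplu_wedge (xS ord0) ?(vT ord0) ?inE ?eqxx // mul0r mulr0 subr0.
Qed.

Lemma G_irreducible : irreducible G.
Proof.
have [x Gx _] := torus_meets (K := K) d3 (or_introl (@subset_refl _ G)).
by rewrite GE; apply: Wset_irreducible => //; rewrite -GE; exists x.
Qed.

Lemma G_dir_irreducible i : (0 < i)%N ->
  irreducible (G `&` [set p | dirvec p i = 0]).
Proof.
move=> i0; have [k [k0 ki _]] := exists_other d3 i i.
rewrite G_dir0E //; apply: Wset_irreducible => //; rewrite -G_dir0E //.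
exists (dirpt (fun l => (l == k)%:R)); split.
  by apply: (dirpt_grassmannian k0); rewrite eqxx oner_eq0.
by rewrite /= dirvec_dirpt // eq_sym (negPf ki).
Qed.

Lemma G_dir_point i j : (0 < i)%N -> (0 < j)%N -> i != j ->
  exists2 x, G x /\ dirvec x i = 0 & dirvec x j != 0.
Proof.
move=> i0 j0 ij; exists (dirpt (fun l => (l == j)%:R)).
  split; last by rewrite dirvec_dirpt // (negPf ij).
  by apply: (dirpt_grassmannian j0); rewrite eqxx oner_eq0.
by rewrite dirvec_dirpt // eqxx oner_eq0.
Qed.

Lemma G_meets_torus : exists2 x, G x & U x.
Proof. by apply: (torus_meets d3); left. Qed.

(** Only F_ij has to be killed. If the third coordinate p_0m vanishes too, [rep_pair_zero] does it;
    if not, the Pluecker relation through 0, i, j, m plays the part that the section p_ij = 0 has on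
    the linear spaces. *)
Lemma G_indeterminacy_zeros x i j : G x -> (0 < i)%N -> (0 < j)%N -> i != j ->
  dirvec x i = 0 -> dirvec x j = 0 -> ~ defined_at G U C x.
Proof.
move=> Gx i0 j0 ij xi xj [F repF /negP[]]; apply/eqP.
have GP := @G_sub_P K d.
have dir_zero := rep_dir_zero G_irreducible GP G_meets_torus repF
  G_dir_irreducible G_dir_point.
have pair_zero := rep_pair_zero G_irreducible GP G_meets_torus repF
  G_dir_irreducible G_dir_point.
apply: (rep_two_zero G_irreducible GP G_meets_torus repF G_dir_irreducible
  G_dir_point Gx i0 j0 ij xi xj).
have [m [m0 mi mj]] := exists_other d3 i j.
have [xm|xm] := eqVneq (dirvec x m) 0.
  exact: (pair_zero x i j m).
have [e fF] := isform_feval repF.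
have fd k : isform 1 (fun p : V => dirvec p k) := isform_dirvec K k.
have fa k l : isform 1 (fun p : V => aplu p k l) := isform_aplu K k l.
(* Substituting the Pluecker relation for p_0m p_ij into F_ij p_0j = F_0i p_ij
   and cancelling p_0j leaves an identity that determines F_ij where
   p_0i = p_0j = 0 and p_0m <> 0. *)
have key y : G y -> aplu (feval F y) i j * dirvec y m -
    (aplu (feval F y) ord0 i * aplu y i m -
     aplu (feval F y) ord0 j * aplu y j m) = 0.
  move: y; apply: (irr_cancel (e := e + 1) (h := fun y => dirvec y j) _ GP _ (fd j)).
  - exact: G_irreducible.
  - apply: isformB; first exact: isformM (fF i j) (fd m).
    by apply: isformB; apply: isformM (fF _ _) (fa _ _).
  - by have [y Gy Uy] := G_meets_torus; exists y => //; apply: Uy.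
  move=> y Gy yj; apply: (mulfI yj); rewrite /= mulr0.
  have R1 := rep_dir G_irreducible GP G_meets_torus repF Gy i0 j0.
  have R2 := rep_pair G_irreducible GP G_meets_torus repF Gy i0 j0.
  have [_ /(_ ord0 i j m) R3] := (grassmannianP y).1 Gy.
  rewrite /plucker -!dirvecE in R3.
  transitivity ((aplu (feval F y) i j * dirvec y j -
      aplu (feval F y) ord0 i * aplu y i j) * dirvec y m +
    (aplu (feval F y) ord0 j * dirvec y j -
      aplu (feval F y) ord0 i * dirvec y i) * aplu y j m +
    aplu (feval F y) ord0 i * (dirvec y i * aplu y j m - dirvec y j * aplu y i m +
      dirvec y m * aplu y i j)); first by ring.
  by rewrite R1 R2 R3 !subrr !mul0r mulr0 !addr0.
have /eqP := key x Gx; have ji : j != i by rewrite eq_sym.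
rewrite (dir_zero x j i) // (dir_zero x i j) // !mul0r !subr0 mulf_eq0.
by rewrite (negPf xm) orbF => /eqP.
Qed.

Lemma indeterminacy_GP x : indeterminacy G U C x <->
  exists i j, [/\ (0 < i)%N, (i < j)%N & [/\ G x, dirvec x i = 0 & dirvec x j = 0]].
Proof.
split=> [[Gx ndef]|[i [j [i0 ij [Gx xi xj]]]]]; last first.
  split=> //; have j0 := ltn_trans i0 ij.
  by apply: (G_indeterminacy_zeros Gx i0 j0); rewrite // neq_ltn ij.
apply: contrapT => ntwo; apply: ndef.
have one i j : (0 < i)%N -> (0 < j)%N -> j != i -> dirvec x i = 0 ->
    dirvec x j != 0.
  move=> i0 j0 ji xi; apply/eqP => xj; apply: ntwo; case: (ltngtP i j) => ij.
  - by exists i, j.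
  - by exists j, i.
  - by rewrite (ord_inj ij) eqxx in ji.
have [[i [i0 xi]]|nz] := pselect (exists i, (0 < i)%N /\ dirvec x i = 0).
  by apply: (@defined_one_zero K d G x i) => // j j0 ji; apply: one xi.
apply: (@defined_one_zero K d G x ord_max) => //=; first exact: ltnW.
by move=> j j0 _; apply/eqP => xj; apply: nz; exists j.
Qed.

Definition affine_two_zero i j : set V :=
  [set p | [/\ G p, dirvec p i = 0 & dirvec p j = 0]] `\` inf.

Lemma two_zero_sub i j :
  two_zero_lines i j `<=` [set p : V | [/\ G p, dirvec p i = 0 & dirvec p j = 0]].
Proof.
apply: zclosure_sub; last by move=> p [].
have := zclosedI (G_dir_closed i) (G_dir_closed j).
congr zclosed; rewrite predeqE => p.
by split=> [[[Gp pi] [_ pj]]|[Gp pi pj]].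
Qed.

Lemma affine_sub_two_zero i j : affine_two_zero i j `<=` @two_zero_lines K d i j.
Proof. exact: sub_zclosure. Qed.

(** Away from infinity row 0 is nonzero: it is the direction vector, with zeros at 0, i and j. Lines
    at infinity must be removed first, since the locus p_0i = p_0j = 0 in G(1,d) is reducible. *)
Lemma affine_two_zeroE i j : (0 < i)%N -> (0 < j)%N -> affine_two_zero i j =
  WS finset.setT (~: [set ord0; i; j])%SET `\` inf.
Proof.
move=> i0 j0; rewrite predeqE => p; split=> [[[Gp pi pj] ninf]|[Wp ninf]]; split=> //.
  have [b pb] : exists b, aplu p ord0 b != 0.
    apply: contrapT => nb; apply: ninf; split=> // l l0; rewrite dirvecE.
    by apply: contrapT => /eqP pl; apply: nb; exists l.
  apply: (WsetI Gp pb) => l; first by rewrite inE.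
  rewrite !inE negbK -orbA; case/or3P => /eqP->; rewrite -?dirvecE //.
  by rewrite dirvecE apluii.
have [_ [x [v [_ vT pE]]]] := Wp.
split; first exact: Wset_grassmannian Wp.
  by rewrite pE dirvecE aplu_wedge !vT ?inE ?eqxx ?orbT // !mulr0 subr0.
by rewrite pE dirvecE aplu_wedge !vT ?inE ?eqxx ?orbT // !mulr0 subr0.
Qed.

Lemma affine_two_zero_dirpt i j k f : (0 < i)%N -> (0 < j)%N -> (0 < k)%N ->
  f i = 0 -> f j = 0 -> f k != 0 -> affine_two_zero i j (dirpt f).
Proof.
move=> i0 j0 k0 fi fj fk; split=> [|[_ /(_ k k0)]].
  by split; rewrite ?dirvec_dirpt //; apply: dirpt_grassmannian fk.
by rewrite dirvec_dirpt // => /eqP; rewrite (negPf fk).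
Qed.

(** The affine lines form a nonempty open part of an irreducible family, and closures preserve
    irreducibility. *)
Lemma two_zero_variety i j : (0 < i)%N -> (0 < j)%N ->
  variety (@two_zero_lines K d i j).
Proof.
move=> i0 j0; apply: variety_closure; last by move=> p [[[]]].
have [k [k0 ki kj]] := exists_other d3 i j.
have Ap : affine_two_zero i j (dirpt (fun l => (l == k)%:R)).
  by apply: (affine_two_zero_dirpt i0 j0 k0);
    rewrite ?(eq_sym i) ?(eq_sym j) ?(negPf ki) ?(negPf kj) ?eqxx ?oner_eq0.
rewrite -/(affine_two_zero i j) affine_two_zeroE // in Ap *.
apply: irr_diff; last by exists (dirpt (fun l => (l == k)%:R)).
  by apply: Wset_irreducible => //; case: Ap => Wp _; eexists; exact: Wp.
exact: inf_closed.
Qed.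

(** An affine line with v_b nonzero is given by its point on z_b = 0 and its direction scaled to v_b
    = 1, which takes d - 1 parameters each. *)
Lemma G_dim : has_dim G (2 * d - 2).
Proof.
have [b [b0 _ _]] := exists_other d3 ord0 ord0.
have -> : (2 * d - 2 = #|~: [set (ord0 : N); b]%SET| + #|~: [set (ord0 : N); b]%SET|)%N.
  by rewrite !cardC_ord !cards_ord2 ?ord0_neq //; lia.
have wG (x v : N -> K) : x ord0 = 1 -> x b = 0 -> v ord0 = 0 -> v b = 1 -> G (wedge x v).
  move=> x0 xb v0 vb; apply: wedge_grassmannian.
  by apply: (aplu_neq0 (i := ord0) (j := b)); rewrite aplu_wedge x0 xb v0 vb mulr1 mulr0 subr0 oner_eq0.
apply: (wedge_chart K_inf (a := ord0) (b := b)) => //;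
  rewrite ?inE ?eqxx ?orbT ?ord0_neq //.
- by split; [exact: G_closed | exact: G_irreducible].
- by move=> x v x0 xb v0 vb _ _; apply: wG.
move=> p Gp pab; split=> l; rewrite !inE negbK => /negPf l0; rewrite l0 ?orbF /=.
  by move=> /eqP->; exact: apluii.
by move=> /eqP->; exact: apluii.
Qed.

Lemma inf_variety : variety inf.
Proof.
split; first exact: inf_closed.
rewrite infE; apply: Wset_irreducible => //; rewrite -infE.
have [a [b [a0 ab]]] := @first_pair d d3; have b0 := ltn_trans a0 ab.
have nab : b != a by rewrite neq_ltn ab orbT.
pose x (l : N) : K := (l == a)%:R; pose v (l : N) : K := (l == b)%:R.
exists (wedge x v); split.
  apply: wedge_grassmannian; apply: (aplu_neq0 (i := a) (j := b)).
  by rewrite aplu_wedge /x /v !eqxx (negPf nab) mul0r subr0 mulr1 oner_eq0.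
by move=> i i0; rewrite dirvecE aplu_wedge /x /v !ord0_neq // !mul0r mulr0 subr0.
Qed.

Lemma inf_dim : has_dim inf (2 * d - 4).
Proof.
have [a [b [a0 ab]]] := @first_pair d d3; have b0 := ltn_trans a0 ab.
have nab : a != b by rewrite neq_ltn ab.
have -> : (2 * d - 4 =
    #|~: [set (ord0 : N); a; b]%SET| + #|~: [set (ord0 : N); a; b]%SET|)%N.
  by rewrite !cardC_ord !cards_ord3 ?ord0_neq //; lia.
apply: (wedge_chart K_inf (a := a) (b := b)) => //;
  rewrite ?inE ?eqxx ?orbT //.
- exact: inf_variety.
- by move=> p [].
- move=> x v xa xb va vb xS vT; split=> [|i i0].
    apply: wedge_grassmannian; apply: (aplu_neq0 (i := a) (j := b)).
    by rewrite aplu_wedge xa xb va vb mulr1 mulr0 subr0 oner_eq0.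
  rewrite dirvecE aplu_wedge (xS ord0) ?(vT ord0) ?inE ?eqxx ?ord0_neq //.
  by rewrite mul0r mulr0 subr0.
move=> p [_ p0] pab; have z l : (0 < l)%N -> aplu p l ord0 = 0.
  by move=> l0; rewrite apluC -dirvecE p0 ?oppr0.
split=> l /negPf lab; rewrite !inE lab negbK ?orbF => /orP[]/eqP->.
- exact: z.
- exact: apluii.
- exact: z.
- exact: apluii.
Qed.

(** For a third index k, the point on z_k = 0 has d - 1 parameters, and the direction with v_k = 1
    and v_i = v_j = 0 has d - 3. *)
Lemma two_zero_dim i j : (0 < i)%N -> (i < j)%N ->
  has_dim (@two_zero_lines K d i j) (2 * d - 4).
Proof.
move=> i0 ij; have j0 := ltn_trans i0 ij.
have nij : i != j by rewrite neq_ltn ij.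
have [k [k0 ki kj]] := exists_other d3 i j.
have -> : (2 * d - 4 =
    #|~: [set (ord0 : N); k]%SET| + #|~: [set (ord0 : N); i; j; k]%SET|)%N.
  rewrite !cardC_ord cards_ord2 ?cards_ord4 ?ord0_neq // 1?eq_sym //.
  by lia.
apply: (wedge_chart K_inf (a := ord0) (b := k)) => //;
  rewrite ?inE ?eqxx ?orbT ?ord0_neq //.
- exact: two_zero_variety.
- by move=> p /two_zero_sub[].
- move=> x v x0 xk v0 vk xS vT; apply: affine_sub_two_zero.
  have vi : v i = 0 by apply: vT; rewrite 1?eq_sym // !inE eqxx ?orbT.
  have vj : v j = 0 by apply: vT; rewrite 1?eq_sym // !inE eqxx ?orbT.
  have wk : aplu (wedge x v) ord0 k != 0.
    by rewrite aplu_wedge x0 xk v0 vk mulr1 mulr0 subr0 oner_eq0.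
  split=> [|[_ /(_ k k0)]]; last by rewrite dirvecE => /eqP; rewrite (negPf wk).
  split; first by apply: wedge_grassmannian; apply: aplu_neq0 wk.
    by rewrite dirvecE aplu_wedge vi v0 !mulr0 subr0.
  by rewrite dirvecE aplu_wedge vj v0 !mulr0 subr0.
move=> p /two_zero_sub[Gp pi pj] pab; split=> l /negPf lab.
  by rewrite !inE lab negbK => /eqP->; exact: apluii.
rewrite !inE lab orbF negbK -orbA; case/or3P => /eqP->; rewrite -?dirvecE //.
by rewrite dirvecE apluii.
Qed.

End Grassmannian.

(** * Components of the indeterminacy locus on G(1,d) *)

Section Components.
Variables (K : fieldType) (d : nat).
Hypothesis K_inf : infinite_set [set: K].
Hypothesis d3 : (3 <= d)%N.
Local Notation V := {ffun pidx d -> K}.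
Local Notation N := 'I_d.+1.
Local Notation U := (@torus K d).
Local Notation C := (@cremona K d).
Local Notation G := (@grassmannian K d).
Local Notation inf := (@lines_at_infinity K d).
Implicit Types (p q x : V) (i j k l m : N).

Let T : finType := option {ij : N * N | (0 < ij.1)%N && (ij.1 < ij.2)%N}.
Let Z (t : T) : set V :=
  if t is Some ij then two_zero_lines (val ij).1 (val ij).2 else inf.

(** For an affine line the relation with indices 0, i, j, m reads p_0m p_ij = 0 with some p_0m
    nonzero. The resulting equation passes to the closure, where it shows that the lines at infinity
    are not all contained in it. *)
Lemma two_zero_plu i j p : two_zero_lines i j p -> aplu p i j = 0.
Proof.
have cZ := zclosed_zeros (@isform_aplu K d i j).
suff sub : @affine_two_zero K d i j `<=` [set p | p != 0 /\ aplu p i j = 0].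
  by move=> /(zclosure_sub cZ sub)[].
move=> q [[Gq qi qj] ninf]; split; first by case: Gq.
have [m qm] : exists m, aplu q ord0 m != 0.
  apply: contrapT => nm; apply: ninf; split=> // l l0; rewrite dirvecE.
  by apply: contrapT => /eqP ql; apply: nm; exists l.
have [_ /(_ ord0 i j m)] := (grassmannianP q).1 Gq.
rewrite /plucker -!dirvecE qi qj !mul0r subr0 add0r => /eqP.
by rewrite dirvecE mulf_eq0 (negPf qm) => /eqP.
Qed.

Lemma component_variety t : variety (Z t).
Proof.
case: t => [[[i j] /= /andP[i0 ij]]|]; last exact: inf_variety.
by apply: two_zero_variety => //; apply: ltn_trans ij.
Qed.

Lemma component_inj t u : Z t `<=` Z u -> t = u.
Proof.
case: t => [[[i j] /= ijP]|]; case: u => [[[k l] /= klP]|] //.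
- have /andP[/= i0 ij] := ijP; have /andP[/= k0 kl] := klP.
  have j0 := ltn_trans i0 ij; have l0 := ltn_trans k0 kl.
  have [m [m0 mi mj]] := exists_other d3 i j.
  (* A direction vanishing exactly at i and j: the line lies in no other family of this kind. *)
  pose f (n : N) : K := if (n == i) || (n == j) then 0 else 1.
  have Af : affine_two_zero i j (dirpt f).
    by apply: (affine_two_zero_dirpt i0 j0 m0);
      rewrite /f ?eqxx ?orbT // (negPf mi) (negPf mj) oner_eq0.
  move=> /(_ _ (affine_sub_two_zero Af))/two_zero_sub[_].
  have f0 n : f n = 0 -> (n == i) || (n == j).
    by rewrite /f; case: ifP => // _ /eqP; rewrite oner_eq0.
  rewrite !dirvec_dirpt // => /f0 kij /f0 lij.
  suff [ik jl] : i = k /\ j = l by subst; congr Some; apply: val_inj.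
  case/orP: kij kl => /eqP->; case/orP: lij => /eqP->; rewrite ?ltnn //.
  by move=> /(ltn_trans ij); rewrite ltnn.
- have /andP[/= i0 ij] := ijP; have j0 := ltn_trans i0 ij.
  have [m [m0 mi mj]] := exists_other d3 i j.
  have Af : affine_two_zero i j (dirpt (fun n : N => (n == m)%:R : K)).
    by apply: (affine_two_zero_dirpt i0 j0 m0);
      rewrite ?(eq_sym i) ?(eq_sym j) ?(negPf mi) ?(negPf mj) ?eqxx ?oner_eq0.
  by move=> /(_ _ (affine_sub_two_zero Af)); case: Af => _ /[apply].
have /andP[/= k0 kl] := klP; have nkl : l != k by rewrite neq_ltn kl orbT.
(* The line at infinity joining the k-th and l-th coordinate points has p_kl = 1, which
   [two_zero_plu] forbids. *)
pose x (n : N) : K := (n == k)%:R; pose v (n : N) : K := (n == l)%:R.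
have wkl : aplu (wedge x v) k l = 1.
  by rewrite aplu_wedge /x /v !eqxx (negPf nkl) mul0r subr0 mulr1.
have infw : inf (wedge x v).
  split=> [|i i0].
    by apply: wedge_grassmannian; apply: (aplu_neq0 (i := k) (j := l)); rewrite wkl oner_eq0.
  have l0 := ltn_trans k0 kl.
  by rewrite dirvecE aplu_wedge /x /v !ord0_neq // !mul0r mulr0 subr0.
by move=> /(_ _ infw)/two_zero_plu/eqP; rewrite wkl oner_eq0.
Qed.

Lemma component_coverP x : indeterminacy G U C x <-> exists t, Z t x.
Proof.
split=> [/(indeterminacy_GP K_inf d3)[i [j [i0 ij [Gx xi xj]]]]|[t]].
  have [infx|ninf] := pselect (inf x); first by exists None.
  have ijP : (0 < (i, j).1)%N && ((i, j).1 < (i, j).2)%N by rewrite /= i0 ij.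
  by exists (Some (exist _ (i, j) ijP)); apply: affine_sub_two_zero.
case: t => [[[i j] /= /andP[i0 ij]] /two_zero_sub[Gx xi xj]|[Gx xinf]].
  by apply/(indeterminacy_GP K_inf d3); exists i, j.
have [i [j [i0 ij]]] := @first_pair d d3.
apply/(indeterminacy_GP K_inf d3); exists i, j; split=> //.
by split=> //; apply: xinf => //; apply: ltn_trans ij.
Qed.

Lemma component_GE W : component (indeterminacy G U C) W <-> exists t, W = Z t.
Proof. exact: (component_cover component_variety component_inj component_coverP). Qed.

Lemma component_GP W : component (indeterminacy G U C) W <->
  W = inf \/ exists i j, [/\ (0 < i)%N, (i < j)%N & W = two_zero_lines i j].
Proof.
split=> [/component_GE[[[[i j] /= /andP[i0 ij]]|] ->]|].
- by right; exists i, j.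
- by left.
case=> [->|[i [j [i0 ij ->]]]]; apply/component_GE; first by exists None.
have ijP : (0 < (i, j).1)%N && ((i, j).1 < (i, j).2)%N by rewrite /= i0 ij.
by exists (Some (exist _ (i, j) ijP)).
Qed.

Lemma component_G_card :
  ([set W | component (indeterminacy G U C) W] #= `I_('C(d, 2).+1))%card.
Proof.
have -> : [set W | component (indeterminacy G U C) W] = [set Z t | t in [set: T]].
  rewrite predeqE => W; split=> [/component_GE[t ->]|[t _ <-]]; first by exists t.
  by apply/component_GE; exists t.
have cT : #|T| = 'C(d, 2).+1.
  by rewrite card_option card_sig -card_pos_pairs.
rewrite -cT; apply: card_eq_trans (card_eq_finType T).
apply: inj_card_eq => t u _ _ tu; apply: component_inj; rewrite tu.
exact: subset_refl.
Qed.

Lemma component_G_codim W : component (indeterminacy G U C) W -> has_codim G W 2.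
Proof.
have dG := G_dim K_inf d3.
have E : (2 * d - 2 = 2 * d - 4 + 2)%N by lia.
rewrite E in dG; move=> /component_GP[->|[i [j [i0 ij ->]]]].
  by split; [move=> p [] | exists (2 * d - 4)%N; split=> //; exact: inf_dim].
split; first by move=> p /two_zero_sub[].
by exists (2 * d - 4)%N; split=> //; exact: two_zero_dim.
Qed.

End Components.

(** * Image of the lines with one zero direction coordinate *)

Section ImageOfOneZero.
Variables (K : fieldType) (d : nat).
Hypothesis K_inf : infinite_set [set: K].
Hypothesis d3 : (3 <= d)%N.
Local Notation V := {ffun pidx d -> K}.
Local Notation N := 'I_d.+1.
Local Notation U := (@torus K d).
Local Notation C := (@cremona K d).
Local Notation G := (@grassmannian K d).
Local Notation LGd := (@LG K d).
Implicit Types (p q x : V) (i j k l m : N).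

Let D : set V :=
  \bigcup_(i in [set i : N | (0 < i)%N]) @one_zero_lines K d i.

(** A projective line with coordinates q_0i and q_im, for any positive m other than i, as
    [image_lineE] makes visible. For d > 3 the union of these lines is too small to fill the
    indeterminacy locus of dimension 2d - 5. *)
Definition image_line i : set V := [set q | LGd q /\
  forall j k, (0 < j)%N -> (j < k)%N -> j != i -> k != i -> L2 j k q].

Lemma image_lineE i m : (0 < i)%N -> (0 < m)%N -> m != i ->
  image_line i = @LGsub K d [set i]%SET [set i]%SET m.
Proof.
move=> i0 m0 mi; rewrite predeqE => q; split=> [[Lq qL]|[Lq qS qT]]; split=> //.
- move=> l l0; rewrite inE => li; rewrite -dirvecE.
  have [k [k0 ki kl]] := exists_other d3 i l.
  case: (ltngtP l k) => lk; last by rewrite (ord_inj lk) eqxx in kl.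
    by have [_ []] := qL l k l0 lk li ki.
  by have [_ []] := qL k l k0 lk ki li.
- move=> l l0; rewrite inE => li; case: (ltngtP m l) => ml.
  + by have [_ [+ _ _]] := qL m l m0 ml mi li; rewrite aplu_lt.
  + by have [_ [+ _ _]] := qL l m l0 ml li mi; rewrite apluC aplu_lt // => ->; rewrite oppr0.
  + by rewrite (ord_inj ml) apluii.
move=> j k j0 jk ji ki; have k0 := ltn_trans j0 jk.
split; first by case: Lq.
split; last 2 first.
- by rewrite dirvecE qS // inE.
- by rewrite dirvecE qS // inE.
have [_ qLG] := (LGP q).1 Lq.
by rewrite -aplu_lt // (qLG m j k) // !qT ?inE // subr0.
Qed.

Lemma image_line_variety i : (0 < i)%N -> variety (image_line i).
Proof.
move=> i0; have [m [m0 mi _]] := exists_other d3 i i.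
rewrite (image_lineE i0 m0 mi).
have [] // := @LGsub_variety_dim K d K_inf [set i]%SET [set i]%SET m.
- by rewrite inE ord0_neq.
- by rewrite inE ord0_neq.
- by rewrite inE.
- by rewrite cards1.
Qed.

Lemma image_line_sub_base i : (0 < i)%N -> image_line i `<=` @base_subspaces K d.
Proof.
move=> i0 q [Lq qL]; have [j [j0 ji _]] := exists_other d3 i i.
have [k [k0 ki kj]] := exists_other d3 i j.
right; case: (ltngtP j k) => jk; last by rewrite (ord_inj jk) eqxx in kj.
  by exists j, k; split=> //; apply: qL.
by exists k, j; split=> //; apply: qL.
Qed.

(** Used to recognize a given point as a value of the transformation by comparing two
    coordinates. *)
Lemma image_line_unique i m q q' : (0 < i)%N -> (0 < m)%N -> m != i ->
  image_line i q -> image_line i q' ->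
  aplu q ord0 i = aplu q' ord0 i -> aplu q i m = aplu q' i m -> q = q'.
Proof.
move=> i0 m0 mi; rewrite (image_lineE i0 m0 mi).
move=> [Lq qS qT] [Lq' qS' qT'] eq0 eqm.
have [_ qL] := (LGP q).1 Lq; have [_ qL'] := (LGP q').1 Lq'.
have e0 l : aplu q ord0 l = aplu q' ord0 l.
  have [l0|l0] := posnP l; first by rewrite (ord_inj (l0 : l = ord0 :> nat)) !apluii.
  by have [->//|li] := eqVneq l i; rewrite qS ?qS' // inE.
have em l : (0 < l)%N -> aplu q m l = aplu q' m l.
  move=> l0; have [->|li] := eqVneq l i; last by rewrite qT ?qT' // inE.
  by rewrite apluC eqm -apluC.
apply: aplu_inj => k l.
have [k0|k0] := posnP k; first by rewrite (ord_inj (k0 : k = ord0 :> nat)).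
have [l0|l0] := posnP l.
  by rewrite (ord_inj (l0 : l = ord0 :> nat)) apluC e0 -apluC.
by rewrite (qL m k l) // (qL' m k l) // !em.
Qed.

Lemma defined_at_one_zero p : D p -> defined_at G U C p.
Proof.
by move=> [i i0 [Gp pi pj]]; apply: (@defined_one_zero K d G p i).
Qed.

(** Values may be computed with any representation. The relations of LG(d) extend from the torus by
    density; the remaining equations are the vanishing results for representations on p_0i = 0. *)
Lemma rep_image_line x i F : (0 < i)%N -> one_zero_lines i x ->
  represents G U C F -> feval F x != 0 -> image_line i (feval F x).
Proof.
move=> i0 [Gx xi xj] repF Fx0; have GP := @G_sub_P K d.
have iG := G_irreducible K_inf d3; have GU := G_meets_torus K d3.
have iGi := G_dir_irreducible K_inf d3; have Gij := @G_dir_point K d.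
have [e fF] := isform_feval repF.
split.
  apply/LGP; split=> // a b c a0 b0 c0; apply/eqP; rewrite -subr_eq0; apply/eqP.
  move: x Gx {xi xj Fx0}; apply: (torus_dense iG GP GU (e := e)).
    by apply: isformB => //; apply: isformB.
  (* On the torus F is proportional to C; the coordinate with indices 0, i of C is nonzero and
     serves as the factor of comparison. *)
  move=> x Gx Ux; have Ci : aplu (C x) ord0 i != 0.
    by rewrite aplu_cremona0 invr_eq0; apply: Ux.
  have rel k l := rep_aplu repF k l ord0 i Gx Ux.
  apply: (mulIf Ci); rewrite mul0r !mulrBl !rel.
  have [_ /(_ a b c a0 b0 c0)->] := (LGP (C x)).1 (cremona_G_LG d3 Gx Ux).
  by ring.
move=> j k j0 jk ji ki; have k0 := ltn_trans j0 jk.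
have ij : i != j by rewrite eq_sym.
have ik : i != k by rewrite eq_sym.
split=> //; split; rewrite ?dirvecE.
- rewrite -aplu_lt //.
  exact: (rep_pair_zero iG GP GU repF iGi Gij Gx j0 k0 i0).
- exact: (rep_dir_zero iG GP GU repF iGi Gij Gx i0).
exact: (rep_dir_zero iG GP GU repF iGi Gij Gx i0).
Qed.

Lemma image_sub_lines :
  rat_image G U C D `<=` [set q | exists2 i : N, (0 < i)%N & image_line i q].
Proof.
move=> y [x [F [[i i0 xi] repF Fx0 [c c0 ->]]]]; exists i => //.
have [cE _] := image_line_variety i0.
by apply: zclosed_scale => //; apply: rep_image_line xi repF Fx0.
Qed.

(** The preimage is an explicit line. The remaining point of the projective line, with q_0i = 0, is
    supplied by the closure. *)
Lemma line_sub_image i q : (0 < i)%N -> image_line i q -> dirvec q i != 0 ->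
  rat_image G U C D q.
Proof.
move=> i0 Eq qi; have [m [m0 mi _]] := exists_other d3 i i.
have [F repF FE] := @cremona_formsP K d.
(* The affine line through the point with i-th coordinate [w] and others 0, with direction 1
   everywhere except 0 at i. All products of direction coordinates are then 1, so F takes the values
   1 at (0, i) and [w] at (i, m), which are those of [q] divided by q_0i. *)
pose w := aplu q i m / dirvec q i.
pose xi (l : N) : K := if l == ord0 then 1 else if l == i then w else 0.
pose v (l : N) : K := ((l != ord0) && (l != i))%:R.
pose x := wedge xi v.
have dv l : dirvec x l = v l.
  by rewrite dirvecE aplu_wedge /xi /v !eqxx mul1r mulr0 subr0.
have v1 l : (0 < l)%N -> l != i -> v l = 1 by move=> l0 li; rewrite /v -ord_gt0 l0 li.
have vi : v i = 0 by rewrite /v eqxx andbF.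
have xline : one_zero_lines i x.
  split; last by move=> l l0 li; rewrite dv v1 // oner_eq0.
    apply: wedge_grassmannian; apply: (aplu_neq0 (i := ord0) (j := m)).
    by rewrite -dirvecE dv v1 // oner_eq0.
  by rewrite dv vi.
have prod1 (A : pred N) : (forall l, A l -> (0 < l)%N /\ l != i) ->
    \prod_(l | A l) dirvec x l = 1.
  by move=> AP; apply: big1 => l /AP[l0 li]; rewrite dv v1.
have F0i : aplu (feval F x) ord0 i = 1.
  rewrite FE // /cremona_form eqxx mul1r prod1 // => l.
  by rewrite !inE orbb negb_or -ord_gt0 => /andP[].
have xim : aplu x i m = w.
  by rewrite aplu_wedge vi mulr0 subr0 v1 // mulr1 /xi eqxx neq0_ord.
have Fim : aplu (feval F x) i m = w.
  case: (ltngtP i m) => im; last by rewrite (ord_inj im) eqxx in mi.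
    rewrite FE // /cremona_form neq0_ord // prod1 ?mulr1 // => l.
    by rewrite !inE !negb_or -ord_gt0 => /andP[/andP[]].
  rewrite apluC FE // /cremona_form neq0_ord // prod1 ?mulr1 -?apluC // => l.
  by rewrite !inE !negb_or -ord_gt0 => /andP[/andP[]].
have Fx0 : feval F x != 0.
  by apply: (aplu_neq0 (i := ord0) (j := i)); rewrite F0i oner_eq0.
exists x, F; split=> //; first by exists i.
exists (dirvec q i) => //.
have [cE _] := image_line_variety i0.
have scale k l : aplu [ffun a => dirvec q i * feval F x a] k l =
    dirvec q i * aplu (feval F x) k l.
  by rewrite (isform_scale _ _ (@isform_aplu K d k l)).
apply: (image_line_unique i0 m0 mi Eq).
- by apply: zclosed_scale => //; apply: rep_image_line.
- by rewrite scale F0i mulr1 dirvecE.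
by rewrite scale Fim /w mulrC divfK.
Qed.

(** The finite union of the projective lines is closed and contains the image. Conversely, a form
    vanishing on the image vanishes on each line where q_0i is nonzero, hence on the whole line by
    irreducibility. *)
Lemma image_closure : zclosure (rat_image G U C D) =
  [set q | exists2 i : N, (0 < i)%N & image_line i q].
Proof.
have cE : zclosed [set q | exists2 i : N, (0 < i)%N & image_line i q].
  have := @zclosed_bigU _ _ _ [seq i : N <- enum 'I_d.+1 | (0 < i)%N] image_line.
  have -> : [set x | exists2 t, t \in [seq i : N <- enum 'I_d.+1 | (0 < i)%N] & image_line t x] =
      [set q | exists2 i : N, (0 < i)%N & image_line i q].
    rewrite predeqE => q; split=> -[i i0 qi]; exists i => //; move: i0;
      by rewrite mem_filter mem_enum andbT.
  by apply=> i; rewrite mem_filter => /andP[i0 _]; have [] := image_line_variety i0.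
rewrite eqEsubset; split; first exact: zclosure_sub image_sub_lines.
move=> q [i i0 Eq]; have [cEi iEi] := image_line_variety i0.
have E0 := zclosed_sub_proj cEi.
apply/zclosureP; first exact: subset_trans image_sub_lines (zclosed_sub_proj cE).
split=> [|e g fg gI]; first exact: E0.
move: q Eq; apply: (irr_cancel iEi E0 fg (isform_dirvec K i)).
  exists (dirpt (fun l => (l == i)%:R)); last by rewrite dirvec_dirpt // eqxx oner_eq0.
  have f0 : ((i == i)%:R : K) != 0 by rewrite eqxx oner_eq0.
  split; first exact: (dirpt_LG i0 f0).
  move=> j k j0 jk ji ki; have k0 := ltn_trans j0 jk.
  split; first exact: (dirpt_neq0 i0 f0).
  split; first by rewrite -aplu_lt // aplu_dirpt.
    by rewrite dirvec_dirpt // (negPf ji).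
  by rewrite dirvec_dirpt // (negPf ki).
by move=> q Eq qi; apply: gI; apply: line_sub_image Eq qi.
Qed.

End ImageOfOneZero.

Theorem theorem10 (K : fieldType) (d : nat) :
  infinite_set [set: K]%classic -> (3 <= d)%N ->
  let P := @proj_space K (pidx d) in
  let G := @grassmannian K d in
  let LGd := @LG K d in
  let U := @torus K d in
  let C := @cremona K d in
  let IndP := indeterminacy P U C in
  let IndG := indeterminacy G U C in
  let IndLG := indeterminacy LGd U C in
  let D := (\bigcup_(i in [set i : 'I_d.+1 | (0 < i)%N]) @one_zero_lines K d i)%classic in
  [/\ [/\ birational_map P P U C,
          (forall p, U p -> U (C p) /\ C (C p) = p)
        & birational_map G LGd U C],
      has_codim P IndP 3 /\ IndP = @base_subspaces K d,
      [/\ ([set Z | component IndG Z]%classic #= `I_('C(d, 2).+1))%card,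
          (forall Z, component IndG Z -> has_codim G Z 2)
        & (forall Z, component IndG Z <->
             Z = @lines_at_infinity K d \/
             exists i j : 'I_d.+1,
               [/\ (0 < i)%N, (i < j)%N & Z = @two_zero_lines K d i j])],
      has_codim LGd IndLG 3 /\ IndLG = (LGd `&` @base_subspaces K d)%classic
    & [/\ (forall p, D p -> defined_at G U C p),
          (rat_image G U C D `<=` IndLG)%classic
        & zclosure (rat_image G U C D) =
          [set q | LGd q /\ exists2 i : 'I_d.+1, (0 < i)%N &
             forall j k : 'I_d.+1, (0 < j)%N -> (j < k)%N ->
               j != i -> k != i -> L2 j k q]%classic]].
Proof.
move=> K_inf d3 P G LGd U C IndP IndG IndLG D.
have vP : variety P := (proj_variety_dim K_inf d3).1.
have vG : variety G by split; [exact: G_closed | exact: G_irreducible].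
have vL : variety LGd := (LG_variety_dim K_inf d3).1.
split.
- split.
  + have CP x : P x -> U x -> P (C x).
      move=> _ /cremonaK[UC _]; have [i [i0 _ _]] := exists_other d3 ord0 ord0.
      by have := UC i i0; rewrite dirvecE; apply: aplu_neq0.
    apply: cremona_birational => //.
    by apply: (torus_meets d3); left; apply: G_sub_P.
  + exact: cremonaK.
  + apply: cremona_birational => //; first exact: G_meets_torus.
      by move=> x; apply: cremona_G_LG.
    by move=> x; apply: cremona_LG_G.
- split; [exact: indeterminacy_proj_codim | exact: indeterminacy_proj].
- split; [exact: component_G_card | exact: component_G_codim | exact: component_GP].
- split; [exact: indeterminacy_LG_codim | exact: indeterminacy_LG].
split.
- by move=> p; apply: defined_at_one_zero.
- move=> q /(image_sub_lines K_inf d3)[i i0 Eq].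
  rewrite /IndLG indeterminacy_LG //; split; first by case: Eq.
  exact: image_line_sub_base Eq.
rewrite image_closure // predeqE => q.
by split=> [[i i0 [Lq qL]]|[Lq [i i0 qL]]]; [split=> //; exists i | exists i].
Qed.
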